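(* For all $k\ge1$, the graph $\Theta^k$ lies in the polywheel subspace of the graph homology space $\mathcal{A}(\emptyset)^k$. Explicitly, if $$\mathrm{Td}^{-1/2}_k=\sum_{(\lambda_1,\ldots,\lambda_j)}a_{(\lambda_1,\ldots,\lambda_j)}\,s_{\lambda_1}\cdots s_{\lambda_j}$$ (sum over the even partitions of $2k$) is the $k$th term of $\mathrm{Td}^{-1/2}$, then in $\mathcal{A}(\emptyset)^k$ $$\Theta^k=48^kk!\sum_{(\lambda_1,\ldots,\lambda_j)}a_{(\lambda_1,\ldots,\lambda_j)}\,\langle w_{\lambda_1}\cdots w_{\lambda_j}\rangle .$$
   Context: $\mathrm{Td}^{-1/2}=\exp\left(\sum_{m\ge1}b_{2m}s_{2m}\right)$, a power series in commuting formal variables $s_2,s_4,s_6,\ldots$, where $\sum_{m\ge1}b_{2m}x^{2m}=\frac12\log\frac{\sinh(x/2)}{x/2}$. Giving $s_{2m}$ weight $m$, $\mathrm{Td}^{-1/2}_k$ is the weight $k$ part. An even partition of $2k$ is a partition into positive even integers. Graph homology. Graphs are finite, trivalent, possibly disconnected. An orientation is an equivalence class of cyclic orderings of the outgoing edges at each vertex, two being equivalent if they differ at an even number of vertices; graphs drawn in the plane carry the anticlockwise orderings. $\mathcal{A}(\emptyset)$ is the space of rational linear combinations of oriented trivalent graphs modulo: (AS) $\bar\Gamma\equiv-\Gamma$, where $\bar\Gamma$ is $\Gamma$ with reversed orientation; (IHX) $\Gamma_I\equiv\Gamma_H-\Gamma_X$ for graphs identical except in a small disc with four boundary legs $a$ (top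 left), $b$ (top right), $c$ (bottom left), $d$ (bottom right), where, with $e$ the internal edge and cyclic orders listed at the two vertices: $\Gamma_I$ has vertices $(b,a,e)$, $(e,c,d)$; $\Gamma_H$ has vertices $(e,a,c)$, $(b,e,d)$; $\Gamma_X$ has vertices $(e,b,c)$, $(a,e,d)$. $\mathcal{A}(\emptyset)^k$ is the part spanned by graphs with $2k$ vertices. A graph also denotes its class. $\Theta$ is the planar theta graph (two vertices joined by three edges) and $\Theta^k$ the disjoint union of $k$ copies. The wheel $w_\lambda$ is a cycle with $\lambda$ vertices, each having one further outward edge (spoke) with a free end, drawn in the plane with spokes pointing outwards. The polywheel $\langle w_{\lambda_1}\cdots w_{\lambda_j}\rangle$ is the sum of all graphs obtained from the disjoint union of $w_{\lambda_1},\ldots,w_{\lambda_j}$ by joining the free ends of the spokes in pairs, one summand for each of the $(2k-1)!!$ perfect pairings of the $2k=\lambda_1+\cdots+\lambda_j$ spokes. The polywheel subspace of $\mathcal{A}(\emptyset)^k$ is the span of the polywheels with $2k$ vertices. *)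

(* Defs.v *)
From HB Require Import structures.
From mathcomp Require Import all_boot all_order all_fingroup all_algebra.
From mathcomp Require Import generic_quotient ring_quotient mpoly.

Set Implicit Arguments.
Unset Strict Implicit.
Unset Printing Implicit Defensive.

Import GRing.Theory.

Local Open Scope ring_scope.
Local Open Scope quotient_scope.

(* The quotient of a vector space by a subspace, as a K-module. The library
   supplies only its additive group structure. *)
Definition vquot (K : fieldType) (vT : vectType K) (U : {vspace vT}) :=
  (Quotient.quot (pred_of_vspace U : zmodClosed vT)).

HB.instance Definition _ (K : fieldType) (vT : vectType K) (U : {vspace vT}) :=
  GRing.Zmodule.on (vquot U).

Definition vclass (K : fieldType) (vT : vectType K) (U : {vspace vT}) (v : vT) :
  vquot U := \pi_((Quotient.quot (pred_of_vspace U : zmodClosed vT))) v.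

Definition vquot_scale (K : fieldType) (vT : vectType K) (U : {vspace vT})
  (a : K) (x : vquot U) : vquot U := vclass U (a *: repr x).

Lemma vclassP (K : fieldType) (vT : vectType K) (U : {vspace vT}) (v w : vT) :
  reflect (vclass U v = vclass U w) (v - w \in U).
Proof.
rewrite (_ : (v - w \in U) = (vclass U v == vclass U w)); first exact: eqP.
exact: Quotient.idealrBE.
Qed.

Lemma vclassD (K : fieldType) (vT : vectType K) (U : {vspace vT}) :
  {morph vclass U : v w / v + w}.
Proof. by move=> v w; rewrite /vclass !piE. Qed.

Lemma vclass_repr (K : fieldType) (vT : vectType K) (U : {vspace vT})
  (x : vquot U) : vclass U (repr x) = x.
Proof. exact: reprK. Qed.

Lemma vclassZ (K : fieldType) (vT : vectType K) (U : {vspace vT}) a v :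
  vclass U (a *: v) = vquot_scale a (vclass U v).
Proof.
apply/vclassP; rewrite -scalerBr; apply: memvZ; apply/vclassP.
by rewrite vclass_repr.
Qed.

Fact vquot_scaleA (K : fieldType) (vT : vectType K) (U : {vspace vT}) a b
  (x : vquot U) : vquot_scale a (vquot_scale b x) = vquot_scale (a * b) x.
Proof. by rewrite -[x]vclass_repr -!vclassZ scalerA. Qed.

Fact vquot_scale1 (K : fieldType) (vT : vectType K) (U : {vspace vT}) :
  left_id 1 (@vquot_scale K vT U).
Proof. by move=> x; rewrite -[x]vclass_repr -vclassZ scale1r. Qed.

Fact vquot_scaleDr (K : fieldType) (vT : vectType K) (U : {vspace vT}) :
  right_distributive (@vquot_scale K vT U) +%R.
Proof.
move=> a x y; rewrite -[x]vclass_repr -[y]vclass_repr.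
by rewrite -vclassD -!vclassZ -vclassD scalerDr.
Qed.

Fact vquot_scaleDl (K : fieldType) (vT : vectType K) (U : {vspace vT})
  (x : vquot U) : {morph (@vquot_scale K vT U)^~ x : a b / a + b}.
Proof.
by move=> a b; rewrite -[x]vclass_repr -!vclassZ -vclassD scalerDl.
Qed.

HB.instance Definition _ (K : fieldType) (vT : vectType K) (U : {vspace vT}) :=
  GRing.Zmodule_isLmodule.Build K (vquot U) (@vquot_scaleA K vT U)
    (@vquot_scale1 K vT U) (@vquot_scaleDr K vT U) (@vquot_scaleDl K vT U).

(* Vertex-oriented trivalent graphs with 2k vertices, presented on a fixed set
   of 6k half-edges: the vertices are the cycles of [vrot], which has all cycles
   of length 3 and gives the cyclic ordering at each vertex; the edges are the
   cycles of the fixed-point free involution [edge]. Loops and multiple edges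
   are allowed, and the graph need not be connected. *)
Definition halfedge (k : nat) := ('I_k.*2 * 'I_3)%type.

Definition is_tgraph (k : nat) (d : {perm halfedge k} * {perm halfedge k}) :=
  [forall h, [&& d.1 h != h, d.1 (d.1 (d.1 h)) == h,
                 d.2 h != h & d.2 (d.2 h) == h]].

Record tgraph (k : nat) := TGraph {
  tgraph_val : {perm halfedge k} * {perm halfedge k};
  _ : is_tgraph tgraph_val
}.

HB.instance Definition _ (k : nat) := [isSub for @tgraph_val k].
HB.instance Definition _ (k : nat) := [Finite of tgraph k by <:].

Definition vrot (k : nat) (G : tgraph k) : {perm halfedge k} := (tgraph_val G).1.
Definition edge (k : nat) (G : tgraph k) : {perm halfedge k} := (tgraph_val G).2.
Definition vertices (k : nat) (G : tgraph k) : {set {set halfedge k}} :=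
  porbits (vrot G).

Definition isomorphic (k : nat) (G G' : tgraph k) : bool :=
  [exists phi : {perm halfedge k},
    (vrot G' == (vrot G ^ phi)%g) && (edge G' == (edge G ^ phi)%g)].

Definition same_graph (k : nat) (G G' : tgraph k) : bool :=
  (edge G == edge G') && (vertices G == vertices G').

(* For [same_graph G G']: the vertices at which the cyclic orderings differ. *)
Definition differing_vertices (k : nat) (G G' : tgraph k) :
    {set {set halfedge k}} :=
  [set v in vertices G | [exists h in v, vrot G h != vrot G' h]].

Definition same_orientation (k : nat) (G G' : tgraph k) : bool :=
  same_graph G G' && ~~ odd #|differing_vertices G G'|.

Definition opposite_orientation (k : nat) (G G' : tgraph k) : bool :=
  same_graph G G' && odd #|differing_vertices G G'|.

Definition has_vertex (k : nat) (G : tgraph k) (x y z : halfedge k) : bool :=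
  [&& vrot G x == y, vrot G y == z & vrot G z == x].

(* [a], [b], [c], [d] are the half-edges on the four legs, and [e], [e'] the
   two halves of the internal edge, [e] being listed in the first vertex. The
   legs may be joined to one another outside the disc. *)
Definition ihx_triple (k : nat) (GI GH GX : tgraph k) : bool :=
  [exists a, exists b, exists c, exists d, exists e, exists e',
    [&& uniq [:: a; b; c; d; e; e'],
        edge GI e == e', edge GH == edge GI, edge GX == edge GI,
        has_vertex GI b a e, has_vertex GI e' c d,
        has_vertex GH e a c, has_vertex GH b e' d,
        has_vertex GX e b c, has_vertex GX a e' d
      & [forall h, (h \notin [:: a; b; c; d; e; e']) ==>
           (vrot GH h == vrot GI h) && (vrot GX h == vrot GI h)]]].

Definition formal (k : nat) := {ffun tgraph k -> rat^o}.

Definition gen (k : nat) (G : tgraph k) : formal k :=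
  [ffun G' => (G == G')%:R].

(* The first two summands pass from vertex-oriented graphs on the fixed set of
   half-edges to isomorphism classes of oriented graphs; the last two are AS
   and IHX. All four preserve the number of vertices, so the degree k part of
   graph homology is presented by the graphs with 2k vertices alone. *)
Definition relations (k : nat) : {vspace formal k} :=
  (\sum_(p : tgraph k * tgraph k | isomorphic p.1 p.2)
      <[gen p.1 - gen p.2]>
   + \sum_(p : tgraph k * tgraph k | same_orientation p.1 p.2)
      <[gen p.1 - gen p.2]>
   + \sum_(p : tgraph k * tgraph k | opposite_orientation p.1 p.2)
      <[gen p.1 + gen p.2]>
   + \sum_(t : tgraph k * tgraph k * tgraph k | ihx_triple t.1.1 t.1.2 t.2)
      <[gen t.1.1 - (gen t.1.2 - gen t.2)]>)%VS.

Definition graph_homology (k : nat) := vquot (relations k).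
HB.instance Definition _ (k : nat) := GRing.Lmodule.on (graph_homology k).

Definition gclass (k : nat) (G : tgraph k) : graph_homology k :=
  vclass (relations k) (gen G).

(* In graphs drawn explicitly below, the half-edges at the vertex v are
   (v, 0), (v, 1), (v, 2), in anticlockwise order. *)
Definition std_rot_fun (k : nat) (h : halfedge k) : halfedge k :=
  (h.1, ordS h.2).

Fact std_rot_inj (k : nat) : injective (@std_rot_fun k).
Proof.
move=> [v i] [w j] E.
by congr pair; [exact: (congr1 fst E) | exact: ordS_inj (congr1 snd E)].
Qed.

Definition std_rot (k : nat) : {perm halfedge k} := perm (@std_rot_inj k).

(* k copies of the planar theta graph, on the vertices 2i (left) and 2i+1
   (right). Anticlockwise, the edges leave the left vertex in the order bottom,
   middle, top and the right vertex in the order top, middle, bottom. *)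
Definition theta_mate_nat (v : nat) : nat := if odd v then v.-1 else v.+1.

Fact theta_mate_lt (k : nat) (v : 'I_k.*2) : (theta_mate_nat v < k.*2)%N.
Proof.
case: v => v /= lt_v; rewrite /theta_mate_nat; case: ifP => [_|ev].
  exact: leq_ltn_trans (leq_pred v) lt_v.
rewrite ltn_neqAle lt_v andbT; apply: contraFneq ev => E.
by rewrite -[odd v]negbK -oddS E odd_double.
Qed.

Definition theta_mate (k : nat) (v : 'I_k.*2) : 'I_k.*2 :=
  Ordinal (theta_mate_lt v).

Definition theta_edge_fun (k : nat) (h : halfedge k) : halfedge k :=
  (theta_mate h.1, rev_ord h.2).

Fact theta_mateK (k : nat) : involutive (@theta_mate k).
Proof.
case=> v lt_v; apply: val_inj; rewrite /= /theta_mate_nat.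
case: v {lt_v} => [|v] //=.
by case ov: (odd v); rewrite /= ov.
Qed.

Fact theta_edgeK (k : nat) : involutive (@theta_edge_fun k).
Proof. by move=> [v i]; rewrite /theta_edge_fun /= theta_mateK rev_ordK. Qed.

Definition theta_edge (k : nat) : {perm halfedge k} :=
  perm (inv_inj (@theta_edgeK k)).

Fact theta_is_tgraph (k : nat) : is_tgraph (std_rot k, theta_edge k).
Proof.
apply/forallP => -[v i] /=; rewrite !permE /= /std_rot_fun /= theta_edgeK eqxx.
rewrite andbT; apply/and3P; split.
- by rewrite xpair_eqE eqxx /=; case: i => [[|[|[|]]]].
- by rewrite xpair_eqE eqxx /= -val_eqE /=; case: i => [[|[|[|]]]].
rewrite xpair_eqE negb_and; apply/orP; left; rewrite -val_eqE /=.
rewrite /theta_mate_nat; case: v => [[|v] lt_v] //=.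
by case: ifP => _; [rewrite neq_ltn leqnn | rewrite neq_ltn ltnSn orbT].
Qed.

Definition theta_graph (k : nat) : tgraph k := TGraph (theta_is_tgraph k).

Definition is_intpart (n : nat) (p : n.-bseq 'I_n.+1) : bool :=
  let s := [seq val i | i <- p] in
  [&& sorted geq s, 0 \notin s & sumn s == n].

(* The bounds on the number and the size of the parts are implied by the parts
   being positive with sum n; they serve to make this a finite type. *)
Record intpart (n : nat) := IntPart {
  intpart_val : n.-bseq 'I_n.+1;
  _ : is_intpart intpart_val
}.

HB.instance Definition _ (n : nat) := [isSub for @intpart_val n].
HB.instance Definition _ (n : nat) := [Finite of intpart n by <:].

Definition parts (n : nat) (lam : intpart n) : seq nat :=
  [seq val i | i <- intpart_val lam].

Definition is_even (n : nat) (lam : intpart n) : bool :=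
  all (fun p => ~~ odd p) (parts lam).

(* The disjoint union of wheels of sizes [sh] has its rim vertices numbered
   consecutively, wheel by wheel and anticlockwise round each rim; this is the
   vertex following [v]. *)
Definition wheel_next (sh : seq nat) (v : nat) : nat :=
  let r := reshape_index sh v in
  flatten_index sh r ((reshape_offset sh v).+1 %% nth 0 sh r).

(* Anticlockwise at a rim vertex: the rim edge from the preceding vertex, the
   (outward) spoke, the rim edge to the following vertex. *)
Definition rim_prev : 'I_3 := @Ordinal 3 0 isT.
Definition spoke : 'I_3 := @Ordinal 3 1 isT.
Definition rim_next : 'I_3 := @Ordinal 3 2 isT.

(* [G] arises from the wheels of sizes [sh] by joining the spokes in pairs.
   Such [G], being labelled, correspond bijectively to the perfect pairings of
   the spokes, so that [polywheel] has one summand for each pairing. *)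
Definition joins_wheels (k : nat) (sh : seq nat) (G : tgraph k) : bool :=
  (vrot G == std_rot k) &&
  [forall v : 'I_k.*2,
    [&& (edge G (v, rim_next)).1 == wheel_next sh v :> nat,
        (edge G (v, rim_next)).2 == rim_prev
      & (edge G (v, spoke)).2 == spoke]].

Definition polywheel (k : nat) (lam : intpart k.*2) : graph_homology k :=
  \sum_(G : tgraph k | joins_wheels (parts lam) G) gclass G.

Definition in_polywheel_subspace (k : nat) (x : graph_homology k) : Prop :=
  exists c : intpart k.*2 -> rat,
    x = \sum_(lam : intpart k.*2) c lam *: polywheel lam.

(* Formal power series are truncated where the omitted terms cannot contribute
   to the coefficient being extracted. *)

(* sinh(x/2) / (x/2) = sum_j x^(2j) / (2^(2j) (2j+1)!), up to degree 2N. *)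
Definition sinhc_half (N : nat) : {poly rat} :=
  \sum_(j < N.+1) (2%:R ^+ j.*2 * (j.*2.+1)`!%:R)^-1 *: 'X^(j.*2).

(* log f = sum_(n >= 1) (-1)^(n+1) (f - 1)^n / n, up to n = N. *)
Definition log_trunc (N : nat) (f : {poly rat}) : {poly rat} :=
  \sum_(1 <= n < N.+1) ((-1) ^+ n.+1 / n%:R) *: (f - 1) ^+ n.

(* b_coef m is the coefficient b_(2m) of x^(2m). As sinhc_half - 1 is divisible
   by x^2, both truncations at m are harmless. *)
Definition b_coef (m : nat) : rat :=
  2%:R^-1 * (log_trunc m (sinhc_half m))`_(m.*2).

(* s_(2m), for 1 <= m <= k, is the variable of index m - 1, whose weight for
   the library's [mnmwgt] is m. *)
Definition svar (k p : nat) : {mpoly rat[k]} :=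
  if insub p./2.-1 is Some i then 'X_i else 0.

(* The weight k part of exp (sum_m b_(2m) s_(2m)): the exponent has no term of
   weight 0, so only s_2, ..., s_(2k) and powers up to the k-th contribute. *)
Definition Td_inv_sqrt (k : nat) : {mpoly rat[k]} :=
  pihomog (@mnmwgt k) k
    (\sum_(n < k.+1)
       (n`!%:R)^-1 *: (\sum_(1 <= m < k.+1) b_coef m *: svar k m.*2) ^+ n).

Definition s_monomial (k : nat) (lam : intpart k.*2) : {mpoly rat[k]} :=
  \prod_(p <- parts lam) svar k p.

(* Main.v *)
(* Call a graph with legs "glued" when its legs are paired off in all possible
   ways, and let W_j(p) be the gluing of j copies of Theta together with a
   polynomial p in wheels, s_(2m) standing for w_(2m). Fix a spoke of a wheel and
   sum over the legs it may be joined to. Joining two spokes of one wheel gives a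
   theta graph with p, q and 0 legs on its three edges, up to the sign (-1)^q;
   joining spokes of two even wheels gives two loops connected by an edge, which
   IHX turns into -2 times such a theta graph. By IHX again, a leg can be slid
   through a vertex, so that theta graphs with p, q and r legs behave like the
   monomials x^p y^q z^r modulo x + y + z, invariant under cyclic permutation.

   For Td^(-1/2) = exp(sum_m b_(2m) s_(2m)) the resulting polynomials in x, y, z
   are the homogeneous parts of the cyclic sum of
     (g(x) + g(y))/(x + y) - g(x) g(y),   g(x) = coth(x/2)/2 - 1/x,
   and this sum is the constant 1/4 when x + y + z = 0, by the addition theorem
   of coth. So only the theta graph without legs survives: in the total weight k,
     48 (k - j) W_j(Td^(-1/2)) = W_(j+1)(Td^(-1/2)),
   and iterating from j = 0 to j = k gives the theorem. *)

Require Import Defs.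
From mathcomp Require Import all_boot all_fingroup all_algebra.
From mathcomp Require Import ssrcomplements mpoly zify ring.

Set Implicit Arguments.
Unset Strict Implicit.
Unset Printing Implicit Defensive.

Import GRing.Theory Num.Theory.
Local Open Scope ring_scope.

(** The rotation is kept equal to [std_rot], so a graph is just a fixed-point free involution of one
    fixed set of half-edges, and every move is a permutation of half-edges; a transposition at one
    vertex is AS. A graph with legs is a list of prescribed values, and gluing it means summing over
    all permutations with these values, those that are not fixed-point free involutions counting 0.
    So no space of diagrams with legs is needed. The sum depends only on the numbers of legs and
    wheels, since any enumeration of the vertices can be relabelled into any other.

    The wheel whose spoke is expanded is singled out by the weighted Euler operator $\sum_m m\,
    s_{2m}\,\partial/\partial s_{2m}$, and $\partial/\partial s_{2m}$ multiplies the exponential by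
    $b_{2m}$. Joins inside one wheel are therefore linear, and joins of two wheels quadratic, in the
    numbers $4m\,b_{2m}$, which are the coefficients of $g$. The constant is $48 = 4\cdot 12$: a 4
    from $m\,b_{2m} = \frac14 g_{2m-1}$, and 12 because the $1/4$ of the addition theorem is shared
    by three cyclic rotations. That theorem is derived from the Riccati equation of $g$, which makes
    sense for truncated series. *)

Local Notation prv v := (v, rim_prev).
Local Notation spk v := (v, spoke).
Local Notation nxt v := (v, rim_next).

(** * Graphs as involutions of the half-edges *)

Section HomologyRelations.
Variable k : nat.
Implicit Types G : tgraph k.

Lemma gclass_isomorphic G G' : isomorphic G G' -> gclass G = gclass G'.
Proof.
move=> iGG'; apply/vclassP; rewrite /relations.
rewrite memvE; do 3 apply: (subv_trans _ (addvSl _ _)).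
by apply: (sumv_sup (G, G')); [|exact: subvv].
Qed.

Lemma gclass_opposite G G' : opposite_orientation G G' -> gclass G = - gclass G'.
Proof.
move=> oGG'; apply/eqP; rewrite -addr_eq0; apply/eqP.
have D := @vclassD _ _ (relations k).
have z : vclass (relations k) 0 = 0 :> graph_homology k.
  by apply: (addrI (vclass (relations k) 0 : graph_homology k)); rewrite -[LHS]D !addr0.
rewrite -z -[LHS]D; apply/vclassP; rewrite subr0 /relations.
rewrite memvE; apply: (subv_trans _ (addvSl _ _)).
by apply: (subv_trans _ (addvSr _ _)); by apply: (sumv_sup (G, G')); [|exact: subvv].
Qed.

Lemma gclassB_ihx GI GH GX : ihx_triple GI GH GX ->
  gclass GI = gclass GH - gclass GX :> graph_homology k.
Proof.
move=> ihx; have D := @vclassD _ _ (relations k).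
apply: (addIr (gclass GX : graph_homology k)); rewrite subrK -[LHS]D.
apply/vclassP; rewrite -addrA -[X in _ + X]opprB /relations.
rewrite memvE; apply: (subv_trans _ (addvSr _ _)).
by apply: (sumv_sup (GI, GH, GX)); [|exact: subvv].
Qed.

End HomologyRelations.

Section InvolutionClasses.
Variable k : nat.
Implicit Types (r e phi : {perm halfedge k}) (h : halfedge k) (u v x : 'I_k.*2).

(* [0] when [(r, e)] is not a trivalent graph. *)
Definition rot_class r e : graph_homology k :=
  if (insub (r, e) : option (tgraph k)) is Some G then gclass G else 0.

Definition edge_class e := rot_class (std_rot k) e.

Lemma is_tgraphJ r e phi : is_tgraph (r ^ phi, e ^ phi)%g = is_tgraph (r, e).
Proof.
have imp r' e' psi : is_tgraph (r', e') -> is_tgraph (r' ^ psi, e' ^ psi)%g.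
  move=> /forallP tg; apply/forallP => h; have := tg (psi^-1 h)%g.
  set g := (psi^-1 h)%g => tgh; rewrite -[h](permKV psi) -/g /= !permJ.
  by move: tgh; rewrite /= !(inj_eq (@perm_inj _ psi)).
by apply/idP/idP => [/(imp _ _ phi^-1%g)|/imp//]; rewrite !conjgK.
Qed.

Lemma rot_classJ r e phi : rot_class (r ^ phi)%g (e ^ phi)%g = rot_class r e.
Proof.
rewrite /rot_class; case: insubP => [G|]; rewrite is_tgraphJ.
  move=> tG EG; case: insubP => [G' _ EG'|/negP//].
  apply/esym/gclass_isomorphic; apply/existsP; exists phi.
  by rewrite /vrot /edge EG EG' /= !eqxx.
by case: insubP => // G' ->.
Qed.

Lemma porbit_fibre r h :
    (forall h, [&& (r h).1 == h.1, r h != h & r (r (r h)) == h]) ->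
  porbit r h = [set h' | h'.1 == h.1].
Proof.
move=> rP; have rF h' : (r h').1 = h'.1 by case/andP: (rP h') => /eqP.
apply/eqP; rewrite eqEcard; apply/andP; split.
  apply/subsetP => h' /porbitP[i ->]; rewrite inE; apply/eqP.
  by rewrite permX; elim: i => //= i IH; rewrite rF.
have ->: [set h' : halfedge k | h'.1 == h.1] = [set (h.1, i) | i : 'I_3].
  apply/setP => -[v i]; rewrite inE /=; apply/eqP/imsetP => [->|[j _ [-> _]]//].
  by exists i.
rewrite card_imset ?card_ord; last by move=> i j [].
have /and3P[_ r1 /eqP r3] := rP h; have /and3P[_ r2 _] := rP (r h).
have u3 : uniq [:: h; r h; r (r h)].
  rewrite /= !inE negb_or (eq_sym h (r h)) r1 (eq_sym (r h) (r _)) r2 andbT /=.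
  by rewrite andbT; apply: contra r1 => /eqP E; rewrite -{2}r3 -E.
have c3 : #|[:: h; r h; r (r h)]| = 3%N by apply/card_uniqP.
apply: leq_trans (_ : #|[:: h; r h; r (r h)]| <= _)%N; first by rewrite c3.
apply/subset_leq_card/subsetP => h'.
rewrite !inE => /or3P[] /eqP->; rewrite ?porbit_id //.
  by have := mem_porbit r 1 h; rewrite expg1.
by have := mem_porbit r 2 h; rewrite expgS expg1 permM.
Qed.

Lemma std_rotE v i : std_rot k (v, i) = (v, ordS i).
Proof. by rewrite permE. Qed.

Lemma ordS3 : (ordS rim_prev = spoke) * (ordS spoke = rim_next) *
              (ordS rim_next = rim_prev).
Proof. by do !split; apply: val_inj. Qed.

Lemma I3P (P : 'I_3 -> Prop) : P rim_prev -> P spoke -> P rim_next ->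
  forall i, P i.
Proof.
move=> P0 P1 P2 [[|[|[|//]]] i3]; first by rewrite (_ : Ordinal _ = rim_prev) //; apply: val_inj.
  by rewrite (_ : Ordinal _ = spoke) //; apply: val_inj.
by rewrite (_ : Ordinal _ = rim_next) //; apply: val_inj.
Qed.

Definition fpf_inv e := [forall h, (e h != h) && (e (e h) == h)].

Lemma std_rot_fibre h : [&& (std_rot k h).1 == h.1, std_rot k h != h
    & std_rot k (std_rot k (std_rot k h)) == h].
Proof. by case: h => v; apply: I3P; rewrite !std_rotE !ordS3 /= !xpair_eqE !eqxx. Qed.

Lemma is_tgraph_fibre r e :
    (forall h, [&& (r h).1 == h.1, r h != h & r (r (r h)) == h]) ->
  is_tgraph (r, e) = fpf_inv e.
Proof.
move=> rP; apply: eq_forallb => h /=.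
by have /and3P[_ -> ->] := rP h.
Qed.

(** Undoing the transposition by an isomorphism moves it from the edges to the rotation, which
    becomes the reversed one at [v] and stays the same elsewhere. This is AS at a single vertex. *)
Lemma edge_class_flip e v i j : i != j ->
  edge_class (e ^ tperm (v, i) (v, j)) = - edge_class e.
Proof.
move=> nij; pose t := tperm (v, i) (v, j); rewrite -/t.
have tt : (t^-1 = t)%g by rewrite tpermV.
have tC : (t * t = 1)%g by rewrite tperm2.
rewrite /edge_class.
rewrite -[in LHS](rot_classJ _ _ t) -conjgM tC conjg1.
have rE h : (std_rot k ^ t)%g h = t (std_rot k (t h)).
  by rewrite conjgE tt !permM.
pose R' := (std_rot k ^ t)%g.
have R'v l : R' (v, l) = (v, ord_pred l).
  rewrite /R' rE /t; clear -nij; move: i j l nij.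
  do 3 apply: I3P; rewrite ?eqxx //= => _; rewrite /tperm !permE /= !xpair_eqE !eqxx /=;
    rewrite /std_rot_fun /= ?ordS3 ?xpair_eqE ?eqxx /=;
    by congr pair; apply: val_inj.
have R'w w l : w != v -> R' (w, l) = std_rot k (w, l).
  move=> wv; have D (l' m : 'I_3) : (v, m) != (w, l') by apply: contra_neq wv => -[].
  by rewrite /R' rE /t (tpermD (D _ _) (D _ _)) std_rotE (tpermD (D _ _) (D _ _)).
have R'P h : [&& (R' h).1 == h.1, R' h != h & R' (R' (R' h)) == h].
  case: h => w l; have [->|wv] := eqVneq w v.
    by rewrite !R'v !xpair_eqE !eqxx /=; clear; move: l; apply: I3P.
  rewrite !R'w ?std_rotE // ?R'w ?std_rotE // ?R'w ?std_rotE //.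
  have := std_rot_fibre (w, l); by rewrite !std_rotE.
rewrite /rot_class; case: insubP => [G|]; rewrite (is_tgraph_fibre _ R'P); last first.
  case: insubP => [G|]; last by rewrite oppr0.
  by rewrite (is_tgraph_fibre _ std_rot_fibre) => ->.
move=> fe EG; case: insubP => [G'|]; rewrite (is_tgraph_fibre _ std_rot_fibre) ?fe //.
move=> _ EG'; apply: gclass_opposite; apply/andP; split.
  rewrite /same_graph /edge EG EG' eqxx /=; apply/eqP.
  rewrite /vertices /vrot EG EG' /porbits; apply: eq_imset => h.
  by rewrite (porbit_fibre _ R'P) (porbit_fibre _ std_rot_fibre).
rewrite (_ : differing_vertices G G' = [set [set h | h.1 == v]]) ?cards1 //.
apply/setP => A; rewrite !inE /vertices /vrot EG EG' /=.
apply/andP/eqP => [[/imsetP[h _ ->]] /existsP[[w l]]|->].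
  rewrite (porbit_fibre _ R'P) inE /=.
  case/andP=> /eqP <-; have [->//|wv] := eqVneq w v.
  by rewrite R'w // eqxx.
split; first by apply/imsetP; exists (v, i) => //; rewrite (porbit_fibre _ R'P).
apply/existsP; exists (v, rim_prev); rewrite inE eqxx /= R'v std_rotE.
by rewrite xpair_eqE eqxx.
Qed.

Lemma edge_class_invalid e : ~~ fpf_inv e -> edge_class e = 0.
Proof.
rewrite /edge_class /rot_class; case: insubP => // G.
by rewrite (is_tgraph_fibre _ std_rot_fibre) => ->.
Qed.

Lemma has_vertexJ G r e phi (a b c : halfedge k) :
    tgraph_val G = (r ^ phi^-1, e)%g ->
  r (phi a) = phi b -> r (phi b) = phi c -> r (phi c) = phi a ->
  has_vertex G a b c.
Proof.
move=> EG ab bc ca; rewrite /has_vertex /vrot EG /=.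
have E y z : r (phi y) = phi z -> (r ^ phi^-1)%g y = z.
  by move=> yz; rewrite -{1}[y](permK phi) permJ yz permK.
by rewrite (E _ _ ab) (E _ _ bc) (E _ _ ca) !eqxx.
Qed.

Lemma tpermE_if (T : finType) (a b c : T) :
  tperm a b c = if c == a then b else if c == b then a else c.
Proof. by rewrite /tperm permE. Qed.

(* IHX at the edge joining [u] and [x], as a Jacobi identity: two 3-cycles of
   half-edges move the leg [spk x] to the other two edges at [u]. *)
Lemma edge_class_ihx e u x : u != x -> e (prv u) = prv x ->
  edge_class e
  + edge_class (e ^ (tperm (nxt x) (prv u) * tperm (nxt x) (spk u)))
  + edge_class (e ^ (tperm (nxt x) (prv u) * tperm (nxt x) (nxt u))) = 0.
Proof.
move=> ux eux.
have [fe|fe] := boolP (fpf_inv e); last first.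
  have F phi : ~~ fpf_inv (e ^ phi)%g.
    apply: contra fe => /forallP F; apply/forallP => h.
    by have := F (phi h); rewrite !permJ !(inj_eq (@perm_inj _ _)).
  by rewrite !edge_class_invalid // !addr0.
set al := (_ * tperm _ (spk u))%g; set be := (_ * tperm _ (nxt u))%g.
(* [ga] is [be] corrected by the exchange of the two ends of an edge, which fixes [e], and by a flip
   at [x], which costs a sign. It gives the third graph the form of [GH] in [ihx_triple]. *)
pose ga := (tperm (prv u) (prv x) * be * tperm (spk x) (nxt x))%g.
have xu : (x == u) = false by rewrite eq_sym (negbTE ux).
have ux' := negbTE ux.
have alE : ((al (prv x) = prv x) * (al (spk x) = spk x) * (al (spk u) = nxt x)
  * (al (nxt x) = prv u) * (al (prv u) = spk u) * (al (nxt u) = nxt u))%type.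
  rewrite /al !permM; do !split;
  by do !rewrite [tperm _ _ (_, _)]tpermE_if !xpair_eqE ?ux' ?xu ?eqxx /=.
have gaE : ((ga (prv x) = nxt u) * (ga (spk x) = nxt x) * (ga (spk u) = spk u)
  * (ga (nxt x) = prv u) * (ga (prv u) = prv x) * (ga (nxt u) = spk x))%type.
  rewrite /ga /be !permM; do !split;
  by do !rewrite [tperm _ _ (_, _)]tpermE_if !xpair_eqE ?ux' ?xu ?eqxx /=.
have edge_cancel : (e ^ tperm (prv u) (prv x) = e)%g.
  apply/conjg_fixP/commgP/commute_sym/commgP/conjg_fixP; rewrite tpermJ eux.
  by have /andP[_ /eqP] := forallP fe (prv u); rewrite eux tpermC => ->.
have -> : edge_class (e ^ be) = - edge_class (e ^ ga).
  rewrite /ga [in RHS]conjgM edge_class_flip // opprK.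
  by rewrite [in RHS]conjgM edge_cancel.
(* [ihx_triple] compares graphs with the same edges, so the conjugation is moved from [e] to the
   rotation. *)
pose r phi := (std_rot k ^ phi^-1)%g.
have vr phi : is_tgraph (r phi, e).
  rewrite -(is_tgraphJ _ _ phi) /r conjgKV (is_tgraph_fibre _ std_rot_fibre).
  apply/forallP => h; rewrite -[h](permKV phi) !permJ.
  rewrite !(inj_eq (@perm_inj _ _)).
  by have := forallP fe (phi^-1 h)%g.
have cls phi : gclass (TGraph (vr phi)) = edge_class (e ^ phi)%g.
  rewrite /edge_class -[std_rot k](conjgKV phi) rot_classJ /rot_class.
  case: insubP => [G _ EG|/negP[]]; last exact: vr.
  by congr gclass; apply: val_inj.
have v1 : is_tgraph (std_rot k, e) by rewrite (is_tgraph_fibre _ std_rot_fibre).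
have -> : edge_class e = gclass (TGraph v1).
  rewrite /edge_class /rot_class; case: insubP => [G _ EG|/negP//].
  by congr gclass; apply: val_inj.
rewrite (@gclassB_ihx _ _ (TGraph (vr ga)) (TGraph (vr al))); last first.
  apply/existsP; exists (nxt x); apply/existsP; exists (spk x).
  apply/existsP; exists (spk u); apply/existsP; exists (nxt u).
  apply/existsP; exists (prv x); apply/existsP; exists (prv u).
  have fix_ph (phi : {perm halfedge k}) w i : phi (w, i) = (w, i) ->
      phi (std_rot k (w, i)) = std_rot k (w, i) ->
      r phi (w, i) = std_rot k (w, i).
    move=> fi fr; rewrite /r -[in LHS](permK phi (w, i)) permJ.
    by rewrite fi -[X in phi^-1%g X]fr permK.
  apply/andP; split; first by rewrite /= !inE !xpair_eqE ?ux' ?xu ?eqxx.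
  apply/andP; split.
    by rewrite /edge /=; have /andP[_ /eqP] := forallP fe (prv u); rewrite eux => ->.
  do 2 (apply/andP; split; first by rewrite /edge).
  do 2 (apply/andP; split; first by rewrite /has_vertex /vrot /= !std_rotE !ordS3 !eqxx).
  do 2 (apply/andP; split;
    first by apply: (@has_vertexJ _ (std_rot k) e ga); rewrite // !gaE std_rotE ordS3).
  do 2 (apply/andP; split;
    first by apply: (@has_vertexJ _ (std_rot k) e al); rewrite // !alE std_rotE ordS3).
  apply/forallP => -[w i]; apply/implyP => hE.
  have /andP[wu wx] : (w != u) && (w != x).
    move: hE; move: i; apply: I3P; rewrite !inE /= !xpair_eqE /= ?andbF ?andbT ?orbF;
      by rewrite ?negb_or /= andbC.
  have D (v : 'I_k.*2) i' j : w != v -> (v, i') != (w, j).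
    by move=> wv; apply: contra_neq wv => -[].
  have gaD j : ga (w, j) = (w, j) by rewrite /ga /be !permM !tpermD ?D.
  have alD j : al (w, j) = (w, j) by rewrite /al !permM !tpermD ?D.
  by rewrite /vrot /= !fix_ph ?eqxx // ?std_rotE ?gaD ?alD.
by rewrite !cls subrK subrr.
Qed.

End InvolutionClasses.

Definition map_pair (T : Type) (f : T -> T) (p : T * T) := (f p.1, f p.2).

(** * Gluing graphs with legs *)

Section Gluing.
Variable k : nat.
Implicit Types (e phi : {perm halfedge k}) (h a b : halfedge k) (u v x y : 'I_k.*2).
Implicit Types (E C : seq (halfedge k * halfedge k)) (xs P Q R : seq 'I_k.*2).

Definition agrees e E := all (fun p => e p.1 == p.2) E.

(* [E] lists the edges of a graph with legs, the half-edges not occurring in [E]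
   being the legs. *)
Definition glue E : graph_homology k := \sum_(e | agrees e E) edge_class e.

Lemma eq_glue E C : (forall e, fpf_inv e -> agrees e E = agrees e C) ->
  glue E = glue C.
Proof.
move=> EC; rewrite /glue [LHS]big_mkcond [RHS]big_mkcond /=; apply: eq_bigr => e _.
have [/EC->//|/edge_class_invalid->] := boolP (fpf_inv e); by rewrite !if_same.
Qed.

Lemma perm_glue E C : perm_eq E C -> glue E = glue C.
Proof. by move=> EC; apply: eq_glue => e _; exact: perm_all. Qed.

Lemma agrees_swap e a b : fpf_inv e -> (e a == b) = (e b == a).
Proof.
move=> /forallP fe; apply/eqP/eqP => <-.
  by have /andP[_ /eqP] := fe a.
by have /andP[_ /eqP] := fe b.
Qed.

Lemma glue_swap a b E : glue ((a, b) :: E) = glue ((b, a) :: E).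
Proof. by apply: eq_glue => e fe; rewrite /= (agrees_swap _ _ fe). Qed.

Lemma agreesJ e phi E : agrees (e ^ phi) (map (map_pair phi) E) = agrees e E.
Proof.
rewrite /agrees all_map; apply: eq_all => -[a b] /=.
by rewrite permJ (inj_eq (@perm_inj _ _)).
Qed.

Lemma glue_map_sum phi E :
  glue (map (map_pair phi) E) = \sum_(e | agrees e E) edge_class (e ^ phi).
Proof.
rewrite /glue (reindex_inj (conjg_inj phi)) /=.
by apply: eq_bigl => e; rewrite agreesJ.
Qed.

Lemma glue_map phi (c : rat) E :
    (forall e, edge_class (e ^ phi) = c *: edge_class e) ->
  glue (map (map_pair phi) E) = c *: glue E.
Proof.
move=> phiP; rewrite glue_map_sum scaler_sumr.
by apply: eq_bigr => e _; rewrite phiP.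
Qed.

Lemma glue_flip E v i j : i != j ->
  glue (map (map_pair (tperm (v, i) (v, j))) E) = - glue E.
Proof.
by move=> ij; rewrite (glue_map _ (c := -1)) ?scaleN1r // => e; rewrite edge_class_flip ?scaleN1r.
Qed.

Lemma glue_ihx u x E : u != x ->
  glue ((prv u, prv x) :: E)
  + glue ((spk u, prv x) ::
      map (map_pair (tperm (nxt x) (prv u) * tperm (nxt x) (spk u))%g) E)
  + glue ((nxt u, prv x) ::
      map (map_pair (tperm (nxt x) (prv u) * tperm (nxt x) (nxt u))%g) E) = 0.
Proof.
move=> ux; set al := (_ * tperm _ (spk u))%g; set be := (_ * tperm _ (nxt u))%g.
have xu : (x == u) = false by rewrite eq_sym (negbTE ux).
have E1 : (spk u, prv x) = map_pair al (prv u, prv x).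
  rewrite /al /map_pair !permM.
  by do !rewrite [tperm _ _ (_, _)]tpermE_if !xpair_eqE ?(negbTE ux) ?xu ?eqxx /=.
have E2 : (nxt u, prv x) = map_pair be (prv u, prv x).
  rewrite /be /map_pair !permM.
  by do !rewrite [tperm _ _ (_, _)]tpermE_if !xpair_eqE ?(negbTE ux) ?xu ?eqxx /=.
rewrite E1 E2 -!map_cons !glue_map_sum.
rewrite -!big_split /= big1 // => e /andP[/eqP eux _].
exact: edge_class_ihx.
Qed.

Lemma glue_expand h E : glue E = \sum_h' glue ((h, h') :: E).
Proof.
rewrite /glue (partition_big (fun e : {perm _} => e h) predT) //=.
by apply: eq_bigr => h' _; apply: eq_bigl => e; rewrite andbC.
Qed.

Lemma glue_loop h E : glue ((h, h) :: E) = 0.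
Proof.
rewrite /glue big1 // => e /andP[/= /eqP eh _]; apply: edge_class_invalid.
by apply/forallPn; exists h; rewrite eh eqxx.
Qed.

Definition touched E : seq (halfedge k) := flatten [seq [:: p.1; p.2] | p <- E].

Lemma glue_touched h h' E : h \notin touched E -> h' \in touched E ->
  glue ((h, h') :: E) = 0.
Proof.
move=> hE /flattenP[s /mapP[[a b] abE ->]] h'ab.
rewrite /glue big1 // => e /andP[/= /eqP eh /allP/(_ _ abE)/= /eqP eab].
apply: edge_class_invalid; apply/negP => fe; move/negP: hE; apply.
have he : e h' = h by apply/eqP; rewrite -(agrees_swap _ _ fe) eh.
apply/flattenP; exists [:: a; b]; first by apply/mapP; exists (a, b).
move: h'ab; rewrite !inE => /orP[] /eqP E'.
  by rewrite -he E' eab eqxx orbT.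
suff -> : h = a by rewrite eqxx.
by apply: (@perm_inj _ e); rewrite eh eab E'.
Qed.

(** An arc from [a] to [b]. The spokes of [xs] do not occur, so they are legs, all on the same side
    of the arc. *)
Fixpoint chain a xs b : seq (halfedge k * halfedge k) :=
  if xs is x :: xs' then (a, prv x) :: chain (nxt x) xs' b else [:: (a, b)].

(* The vertices of [P], [Q] and [R] carry one leg each. *)
Definition theta u v P Q R :=
  chain (prv u) P (nxt v) ++ chain (spk u) Q (spk v) ++ chain (nxt u) R (prv v).

Definition wheel xs := if xs is x :: xs' then chain (nxt x) xs' (prv x) else [::].

Definition touched_vertices E : seq 'I_k.*2 := map fst (touched E).

Definition fixes_off (S : seq 'I_k.*2) (f : halfedge k -> halfedge k) :=
  forall v i, v \notin S -> f (v, i) = (v, i).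

Lemma fixes_off_tperm S a b : a.1 \in S -> b.1 \in S -> fixes_off S (tperm a b).
Proof.
move=> aS bS v i vS; rewrite tpermD //.
  by apply: contraNneq vS => E; move: aS; rewrite E.
by apply: contraNneq vS => E; move: bS; rewrite E.
Qed.

Lemma map_chain S f a xs b : fixes_off S f -> ~~ has (mem S) xs ->
  map (map_pair f) (chain a xs b) = chain (f a) xs (f b).
Proof.
move=> fS; elim: xs a => //= x xs IH a; rewrite negb_or => /andP[xS xsS].
by rewrite IH // /map_pair /= !fS.
Qed.

Lemma map_untouched S f C : fixes_off S f -> ~~ has (mem S) (touched_vertices C) ->
  map (map_pair f) C = C.
Proof.
move=> fS; rewrite /touched_vertices; elim: C => //= -[[a i] [b j]] C IH.
by rewrite /= !negb_or => /and3P[aS bS CS]; rewrite IH // /map_pair /= !fS.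
Qed.

Lemma touched_vertices_cat E C :
  touched_vertices (E ++ C) = touched_vertices E ++ touched_vertices C.
Proof. by rewrite /touched_vertices /touched map_cat flatten_cat map_cat. Qed.

End Gluing.

(** Equality of edge lists up to order is decided by counting: for an arbitrary predicate it becomes
    a linear identity between the counts on the pieces. *)
Ltac count_simp :=
  do 5 rewrite ?(count_cat, cat_cons, count_rev, flatten_cat, map_cat) /=.

Ltac count_lia :=
  rewrite -?addnA; clear;
  repeat match goal with
  | |- context [nat_of_bool ?b] => let n := fresh "n" in set n := (nat_of_bool b); clearbody n
  | |- context [count ?q ?s] => let n := fresh "n" in set n := (count q s); clearbody n
  end; lia.

Ltac perm_count := let p := fresh "p" in apply/seq.permP => p; count_simp; count_lia.

(** * AS and IHX applied to arcs, wheels and theta graphs *)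

Section LocalMoves.
Variable k : nat.
Implicit Types (e phi : {perm halfedge k}) (h a b : halfedge k) (u v x y : 'I_k.*2).
Implicit Types (E C : seq (halfedge k * halfedge k)) (xs P Q R : seq 'I_k.*2).

Lemma fixes_off_mul (S : seq 'I_k.*2) phi (psi : {perm halfedge k}) :
  fixes_off S phi -> fixes_off S psi -> fixes_off S (phi * psi)%g.
Proof. by move=> f1 f2 v i vS; rewrite permM f1 // f2. Qed.

Lemma has_notin (T : eqType) (S s : seq T) :
  ~~ has (mem S) s = all (fun z => z \notin s) S.
Proof. by rewrite has_sym -all_predC. Qed.

Lemma chain_rcons a xs x b :
  chain a (rcons xs x) b = rcons (chain a xs (prv x)) (nxt x, b).
Proof. by elim: xs a => //= y xs IH a; rewrite IH. Qed.

(** Traversing the arc backwards exchanges [rim_prev] and [rim_next] at each of its vertices, one AS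
    sign per vertex. *)
Lemma glue_rev_chain a xs b C : uniq xs -> a.1 \notin xs -> b.1 \notin xs ->
    ~~ has (mem xs) (touched_vertices C) ->
  glue (chain a xs b ++ C) = (-1) ^+ size xs *: glue (chain b (rev xs) a ++ C).
Proof.
elim: xs a C => [|x xs IH] a C; first by move=> *; rewrite scale1r /= glue_swap.
rewrite !has_notin /= => /andP[xxs uxs]; rewrite !inE !negb_or.
move=> /andP[ax axs] /andP[bx bxs] /andP[xC xsC].
(* The edge leading into [x] is counted as part of the rest, so that the induction hypothesis
   reverses the tail alone. *)
rewrite (perm_glue (C := chain (nxt x) xs b ++ (a, prv x) :: C)); last by perm_count.
rewrite IH // ?has_notin /=; last first.
  apply/allP => y yxs; have /allP/(_ y yxs) yC := xsC.
  rewrite /touched_vertices /= !inE !negb_or -/(touched_vertices C) yC andbT.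
  apply/andP; split; first by apply: contraNneq axs => <-.
  by apply: contraNneq xxs => <-.
rewrite [in RHS]exprS mulN1r scaleNr -scalerN.
congr (_ *: _); apply: oppr_inj; rewrite opprK -(@glue_flip _ _ x rim_prev rim_next isT).
set t := tperm _ _; have ft : fixes_off [:: x] t by apply: fixes_off_tperm; rewrite mem_head.
rewrite map_cat (@map_chain k [:: x] t) /= ?has_notin /= ?mem_rev ?xxs //.
rewrite (@map_untouched k [:: x] t) ?has_notin /= ?xC //.
clear IH; case: a b ax axs bx bxs => [a i] [b j] /= ax axs bx bxs.
have ta : t (a, i) = (a, i) by apply: ft; rewrite inE.
have tb : t (b, j) = (b, j) by apply: ft; rewrite inE.
rewrite /map_pair /= ta tb. rewrite /t tpermL tpermR.
rewrite rev_cons chain_rcons -cats1 -catA /=.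
rewrite (perm_glue (C := ((a, i), nxt x) :: chain (b, j) (rev xs) (prv x) ++ C));
  last by perm_count.
rewrite glue_swap; apply: perm_glue; perm_count.
Qed.

(* The Jacobi relation among the three arcs meeting at [u]. *)
Lemma glue_slide u v x P Q R C : uniq [:: u; v; x] ->
    all (fun z => z \notin P ++ Q ++ R ++ touched_vertices C) [:: u; x] ->
  glue (theta u v (x :: P) Q R ++ C) + glue (theta u v P (x :: Q) R ++ C)
  + glue (theta u v P Q (x :: R) ++ C) = 0.
Proof.
move=> /= /and3P[]; rewrite !inE !negb_or !andbT => /andP[uv ux] vx _.
rewrite !mem_cat !negb_or => /andP[/and4P[uP uQ uR uC] /and4P[xP xQ xR xC]].
have D := (negbTE uv, negbTE ux, negbTE vx, etrans (eq_sym v u) (negbTE uv),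
   etrans (eq_sym x u) (negbTE ux), etrans (eq_sym x v) (negbTE vx)).
pose E := chain (nxt x) P (nxt v) ++ chain (spk u) Q (spk v) ++ chain (nxt u) R (prv v) ++ C.
have map_E (f : {perm halfedge k}) : fixes_off [:: u; x] f ->
    map (map_pair f) E = chain (f (nxt x)) P (nxt v) ++ chain (f (spk u)) Q (spk v)
      ++ chain (f (nxt u)) R (prv v) ++ C.
  move=> ff; have fv i : f (v, i) = (v, i) by apply: ff; rewrite !inE !D.
  rewrite /E !map_cat !(@map_chain k [:: u; x] f) // ?(@map_untouched k [:: u; x] f)
    ?has_notin /= ?uP ?xP ?uQ ?xQ ?uR ?xR ?uC ?xC //.
  by rewrite !fv.
have fixt i j l : fixes_off [:: u; x] (tperm (x, i) (u, j) * tperm (x, i) (u, l))%g.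
  by apply: fixes_off_mul; apply: fixes_off_tperm; rewrite !inE eqxx ?orbT.
rewrite -[RHS](@glue_ihx _ u x E ux) !map_E; try exact: fixt.
rewrite !permM; do !rewrite [tperm _ _ (_, _)]tpermE_if !xpair_eqE ?D ?eqxx /=.
by congr (_ + _ + _); apply: perm_glue; rewrite /theta /E; perm_count.
Qed.

(** One flip at each of two vertices: the AS signs cancel. Two such pairs in succession give
    3-cycles at both vertices, the form in which [flips4] is used. *)
Definition flips2 x y (i j l m : 'I_3) : {perm halfedge k} :=
  (tperm (x, i) (x, j) * tperm (y, l) (y, m))%g.

Lemma fixes_off_flips2 x y i j l m : fixes_off [:: x; y] (flips2 x y i j l m).
Proof. by apply: fixes_off_mul; apply: fixes_off_tperm; rewrite !inE eqxx ?orbT. Qed.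

Lemma edge_class_flips2 e x y i j l m : i != j -> l != m ->
  edge_class (e ^ flips2 x y i j l m) = edge_class e.
Proof. by move=> ij lm; rewrite conjgM !edge_class_flip // opprK. Qed.

Lemma glue_flips2 x y i j l m E : i != j -> l != m ->
  glue (map (map_pair (flips2 x y i j l m)) E) = glue E.
Proof.
move=> ij lm; rewrite (glue_map (c := 1)) ?scale1r // => e.
by rewrite edge_class_flips2 // scale1r.
Qed.

Definition flips4 x y (i j l m i' j' l' m' : 'I_3) : {perm halfedge k} :=
  (flips2 x y i j l m * flips2 x y i' j' l' m')%g.

Lemma fixes_off_flips4 x y i j l m i' j' l' m' :
  fixes_off [:: x; y] (flips4 x y i j l m i' j' l' m').
Proof. by apply: fixes_off_mul; apply: fixes_off_flips2. Qed.

Lemma glue_flips4 x y i j l m i' j' l' m' E :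
    [&& i != j, l != m, i' != j' & l' != m'] ->
  glue (map (map_pair (flips4 x y i j l m i' j' l' m')) E) = glue E.
Proof.
case/and4P=> *; rewrite (glue_map (c := 1)) ?scale1r // => e.
by rewrite conjgM !edge_class_flips2 // scale1r.
Qed.

(** A 3-cycle of the half-edges at [u] and the opposite one at [v] permute the three arcs cyclically
    and respect both cyclic orderings. *)
Lemma glue_theta_cyclic u v P Q R C : u != v ->
    all (fun z => z \notin P ++ Q ++ R ++ touched_vertices C) [:: u; v] ->
  glue (theta u v P Q R ++ C) = glue (theta u v Q R P ++ C).
Proof.
move=> uv /= /andP[]; rewrite !mem_cat !negb_or !andbT.
move=> /and4P[uP uQ uR uC] /and4P[vP vQ vR vC].
have D := (negbTE uv, etrans (eq_sym v u) (negbTE uv)).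
rewrite -[LHS](@glue_flips4 u v rim_prev rim_next rim_prev rim_next
  rim_prev spoke spoke rim_next) //.
set f := flips4 _ _ _ _ _ _ _ _ _ _.
have ff : fixes_off [:: u; v] f := @fixes_off_flips4 _ _ _ _ _ _ _ _ _ _.
rewrite /theta !map_cat !(@map_chain k [:: u; v] f) //
  ?(@map_untouched k [:: u; v] f) // ?has_notin /= ?uP ?vP ?uQ ?vQ ?uR ?vR ?uC ?vC //.
rewrite !permM; do !rewrite [tperm _ _ (_, _)]tpermE_if !xpair_eqE ?D ?eqxx /=.
by apply: perm_glue; perm_count.
Qed.

Lemma mem_touched_chain z a xs b : (z \in touched_vertices (chain a xs b)) =
  [|| z == a.1, z \in xs | z == b.1].
Proof.
elim: xs a => [|x xs IH] a; first by rewrite !inE.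
rewrite [LHS](_ : _ = [|| z == a.1, z == x | z \in touched_vertices (chain (nxt x) xs b)]).
  by rewrite IH /= inE; case: (z == x); rewrite //= !orbT.
by rewrite /touched_vertices /= !inE.
Qed.

Lemma touched_vertices_cons a b C :
  touched_vertices ((a, b) :: C) = a.1 :: b.1 :: touched_vertices C.
Proof. by []. Qed.

(** The chord between [x] and [y] cuts the wheel into an arc [P] from [x] to [y] and an arc [Q] from
    [y] to [x]. Making [Q] run from [x] to [y] as well produces the sign; 3-cycles at [x] and [y]
    then put the three arcs in standard position. *)
Lemma glue_join_same x y P Q C : x != y -> uniq Q ->
    all (fun z => z \notin P ++ Q ++ touched_vertices C) [:: x; y] ->
    ~~ has (mem Q) (P ++ touched_vertices C) ->
  glue ((spk x, spk y) :: chain (nxt x) P (prv y) ++ chain (nxt y) Q (prv x) ++ C)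
  = (-1) ^+ size Q *: glue (theta x y P (rev Q) [::] ++ C).
Proof.
move=> xy uQ /= /andP[]; rewrite !mem_cat !negb_or !andbT.
move=> /and3P[xP xQ xC] /and3P[yP yQ yC] QC.
have D := (negbTE xy, etrans (eq_sym y x) (negbTE xy)).
rewrite (perm_glue (C := chain (nxt y) Q (prv x)
  ++ (spk x, spk y) :: chain (nxt x) P (prv y) ++ C)); last by perm_count.
apply: etrans (glue_rev_chain _ _ _ _) _ => //.
  rewrite has_notin; apply/allP => z zQ; rewrite touched_vertices_cons !inE.
  rewrite touched_vertices_cat mem_cat mem_touched_chain /= !negb_or.
  move: QC; rewrite has_notin => /allP/(_ z zQ); rewrite mem_cat negb_or => /andP[-> ->].
  by rewrite (memPn xQ) ?(memPn yQ).
congr (_ *: _).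
rewrite -[LHS](@glue_flips4 x y rim_prev rim_next rim_prev rim_next
  spoke rim_next rim_prev spoke) //.
set f := flips4 _ _ _ _ _ _ _ _ _ _.
have ff : fixes_off [:: x; y] f := @fixes_off_flips4 _ _ _ _ _ _ _ _ _ _.
rewrite /theta !map_cat map_cons !map_cat !(@map_chain k [:: x; y] f) //
  ?(@map_untouched k [:: x; y] f) // ?has_notin /= ?mem_rev ?xP ?yP ?xQ ?yQ ?xC ?yC //.
rewrite /map_pair /= !permM; do !rewrite [tperm _ _ (_, _)]tpermE_if !xpair_eqE ?D ?eqxx /=.
by apply: perm_glue; perm_count.
Qed.

(** IHX at the edge between the two loops opens them into theta graphs in two ways, which differ in
    the direction of [Q] relative to [P]. The two terms are kept apart here, since their signs agree
    only when [Q] has odd length. *)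
Lemma glue_join_distinct x y P Q C : x != y -> uniq Q ->
    all (fun z => z \notin P ++ Q ++ touched_vertices C) [:: x; y] ->
    ~~ has (mem Q) (P ++ touched_vertices C) ->
  glue ((spk x, spk y) :: chain (nxt x) P (prv x) ++ chain (nxt y) Q (prv y) ++ C)
  = (-1) ^+ size Q *: glue (theta x y P (rev Q) [::] ++ C)
    - glue (theta y x P Q [::] ++ C).
Proof.
move=> xy uQ /= /andP[]; rewrite !mem_cat !negb_or !andbT.
move=> /and3P[xP xQ xC] /and3P[yP yQ yC] QC.
have D := (negbTE xy, etrans (eq_sym y x) (negbTE xy)).
rewrite -[LHS](@glue_flips4 x y rim_prev rim_next rim_prev rim_next
  rim_prev spoke rim_prev spoke) //.
set f := flips4 _ _ _ _ _ _ _ _ _ _.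
have ff : fixes_off [:: x; y] f := @fixes_off_flips4 _ _ _ _ _ _ _ _ _ _.
rewrite map_cons !map_cat !(@map_chain k [:: x; y] f) //
  ?(@map_untouched k [:: x; y] f) // ?has_notin /= ?xP ?yP ?xQ ?yQ ?xC ?yC //.
rewrite /map_pair /= !permM; do !rewrite [tperm _ _ (_, _)]tpermE_if !xpair_eqE ?D ?eqxx /=.
set E := chain _ P _ ++ _.
have fixt j l : fixes_off [:: x; y] (tperm (nxt y) (x, j) * tperm (nxt y) (x, l))%g.
  by apply: fixes_off_mul; apply: fixes_off_tperm; rewrite !inE eqxx ?orbT.
have map_E (g : {perm halfedge k}) : fixes_off [:: x; y] g ->
    map (map_pair g) E = chain (g (spk x)) P (g (nxt x)) ++ chain (g (spk y)) Q (g (nxt y)) ++ C.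
  move=> fg; rewrite /E !map_cat !(@map_chain k [:: x; y] g) //
  ?(@map_untouched k [:: x; y] g) // ?has_notin /= ?xP ?yP ?xQ ?yQ ?xC ?yC //.
have := @glue_ihx _ x y E xy; rewrite !map_E; try exact: fixt.
rewrite !permM; do !rewrite [tperm _ _ (_, _)]tpermE_if !xpair_eqE ?D ?eqxx /=.
move/eqP; rewrite -addrA addr_eq0 => /eqP ->; rewrite opprD addrC.
congr (_ - _).
  rewrite (perm_glue (C := chain (spk y) Q (prv x)
    ++ (nxt x, prv y) :: chain (spk x) P (nxt y) ++ C)); last by perm_count.
  apply: oppr_inj; rewrite opprK; apply: etrans (glue_rev_chain _ _ _ _) _ => //.
    rewrite has_notin; apply/allP => z zQ; rewrite touched_vertices_cons !inE.
    rewrite touched_vertices_cat mem_cat mem_touched_chain /= !negb_or.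
    move: QC; rewrite has_notin => /allP/(_ z zQ); rewrite mem_cat negb_or => /andP[-> ->].
    by rewrite (memPn xQ) ?(memPn yQ).
  rewrite -scalerN; congr (_ *: _).
  rewrite -[RHS](@glue_flip _ _ x rim_prev spoke) //.
  set t := tperm _ _; have ft : fixes_off [:: x; y] t.
    by apply: fixes_off_tperm; rewrite !inE eqxx ?orbT.
  rewrite /theta !map_cat !(@map_chain k [:: x; y] t) //
    ?(@map_untouched k [:: x; y] t) // ?has_notin /= ?mem_rev ?xP ?yP ?xQ ?yQ ?xC ?yC //.
  do !rewrite [tperm _ _ (_, _)]tpermE_if !xpair_eqE ?D ?eqxx /=.
  by apply: perm_glue; perm_count.
rewrite -[LHS](@glue_flips2 y x rim_prev rim_next rim_prev spoke) //.
set t := flips2 _ _ _ _ _ _; have ft : fixes_off [:: y; x] t := @fixes_off_flips2 _ _ _ _ _ _.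
rewrite /theta map_cons !map_cat !(@map_chain k [:: y; x] t) //
  ?(@map_untouched k [:: y; x] t) // ?has_notin /= ?mem_rev ?xP ?yP ?xQ ?yQ ?xC ?yC //.
rewrite /map_pair /= !permM; do !rewrite [tperm _ _ (_, _)]tpermE_if !xpair_eqE ?D ?eqxx /=.
rewrite glue_swap; by apply: perm_glue; perm_count.
Qed.

End LocalMoves.

(** * Wheels and theta graphs *)

Section DiagramValues.
Variable k : nat.
Local Notation V := 'I_k.*2.
Local Notation edges := (seq (halfedge k * halfedge k)).
Implicit Types (e phi : {perm halfedge k}) (h a b : halfedge k) (u v x y : 'I_k.*2).
Implicit Types (E C : seq (halfedge k * halfedge k)) (xs P Q R ts s : seq 'I_k.*2).
Implicit Types (ws : seq (seq 'I_k.*2)) (sh : seq nat).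

Definition relabel_fun (pi : {perm V}) h : halfedge k := (pi h.1, h.2).

Lemma relabel_inj (pi : {perm V}) : injective (relabel_fun pi).
Proof. by move=> [v i] [w j] [/perm_inj-> ->]. Qed.

Definition relabel (pi : {perm V}) := perm (@relabel_inj pi).

Lemma relabelE pi v i : relabel pi (v, i) = (pi v, i).
Proof. by rewrite permE. Qed.

Lemma glue_relabel pi E : glue (map (map_pair (relabel pi)) E) = glue E.
Proof.
rewrite (glue_map (c := 1)) ?scale1r // => e; rewrite scale1r.
rewrite /edge_class -[in RHS](rot_classJ _ _ (relabel pi)).
congr rot_class; apply/permP => h; rewrite -[h](permKV (relabel pi)) permJ.
by case: (((relabel pi)^-1)%g h) => v i; rewrite std_rotE !relabelE std_rotE.
Qed.

Lemma ex_perm_map (T : finType) (s s' : seq T) :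
    (forall z, z \in s) -> uniq s -> uniq s' -> size s = size s' ->
  exists pi : {perm T}, s' = map pi s.
Proof.
case: s => [|x0 s0] all_s us us' ss; first by exists 1%g; apply/nilP; rewrite /nilp -ss.
move: (x0 :: s0) us ss all_s => s us ss all_s.
have idx z : (index z s < size s')%N by rewrite -ss index_mem.
have inj : injective (fun z => nth x0 s' (index z s)).
  move=> v w /eqP; rewrite nth_uniq // => /eqP E.
  by rewrite -[v](nth_index x0 (all_s v)) E nth_index.
exists (perm inj); apply: (@eq_from_nth _ x0); first by rewrite size_map ss.
move=> i; rewrite -ss => lti; rewrite (nth_map x0) // permE.
by rewrite index_uniq.
Qed.

Lemma mem_uniq_full s v : uniq s -> size s = k.*2 -> v \in s.
Proof.
move=> us ss; have sub : {subset s <= enum V} by move=> w _; rewrite mem_enum.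
have le_s : (size (enum V) <= size s)%N by rewrite size_enum_ord ss.
by rewrite (uniq_min_size us sub le_s).2 mem_enum.
Qed.

Lemma ex_relabel s s' : uniq s -> uniq s' -> size s = k.*2 -> size s' = k.*2 ->
  exists pi : {perm V}, s' = map pi s.
Proof.
move=> us us' ss ss'; apply: ex_perm_map => //; last by rewrite ss ss'.
by move=> v; apply: mem_uniq_full.
Qed.

(** A diagram is a pattern filled in with a list of all vertices. Relabelling vertices commutes with
    [std_rot] and so is an isomorphism without sign; for an equivariant pattern the list is thus
    immaterial. *)
Definition relabelling_invariant (D : seq V -> edges) :=
  forall (pi : {perm V}) s, D (map pi s) = map (map_pair (relabel pi)) (D s).

Lemma glue_invariant D s s' : relabelling_invariant D -> uniq s -> uniq s' ->
  size s = k.*2 -> size s' = k.*2 -> glue (D s) = glue (D s').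
Proof.
move=> Dinv us us' ss ss'; have [pi ->] := ex_relabel us us' ss ss'.
by rewrite Dinv glue_relabel.
Qed.

Fixpoint thetas s : edges :=
  if s is u :: v :: s' then theta u v [::] [::] [::] ++ thetas s' else [::].

Definition wheels ws : edges := flatten (map (@wheel k) ws).

Definition wheel_diagram j sh s : edges :=
  thetas (take j.*2 s) ++ wheels (reshape sh (drop j.*2 s)).

Definition theta_diagram j sh p q r s : edges :=
  if s is u :: v :: s' then
    theta u v (take p s') (take q (drop p s')) (take r (drop q (drop p s')))
      ++ wheel_diagram j sh (drop r (drop q (drop p s')))
  else [::].

(* [j] copies of [Theta] together with wheels of sizes [sh], and then also with a
   theta graph whose edges carry [p], [q] and [r] legs; both are [0] when the
   number of vertices is not [2k]. *)
Definition wheel_val j sh : graph_homology k :=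
  if (j.*2 + sumn sh == k.*2)%N then glue (wheel_diagram j sh (enum V)) else 0.

Definition theta_val j sh p q r : graph_homology k :=
  if (j.*2.+2 + (p + q + r) + sumn sh == k.*2)%N
  then glue (theta_diagram j sh p q r (enum V)) else 0.

Lemma map_chain_relabel (pi : {perm V}) a xs b : map (map_pair (relabel pi)) (chain a xs b)
  = chain (relabel pi a) (map pi xs) (relabel pi b).
Proof. by elim: xs a => //= x xs IH a; rewrite IH /map_pair /= !relabelE. Qed.

Lemma thetas_relabel : relabelling_invariant thetas.
Proof.
move=> pi s; have [n] := ubnP (size s); elim: n s => // n IH [|u [|v s]] //= ss.
by rewrite IH /theta /map_pair /= ?relabelE //; lia.
Qed.

Lemma wheels_relabel (pi : {perm V}) ws :
  wheels (map (map pi) ws) = map (map_pair (relabel pi)) (wheels ws).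
Proof.
rewrite /wheels map_flatten -!map_comp; congr flatten; apply: eq_map => -[|x xs] //=.
by rewrite map_chain_relabel !relabelE.
Qed.

Lemma map_reshape (T U : Type) (f : T -> U) sh' (s : seq T) :
  reshape sh' (map f s) = map (map f) (reshape sh' s).
Proof. by elim: sh' s => //= n sh' IH s; rewrite -map_take -map_drop IH. Qed.

Lemma wheel_diagram_relabel j sh : relabelling_invariant (wheel_diagram j sh).
Proof.
move=> pi s; rewrite /wheel_diagram map_cat -map_take -map_drop.
by rewrite thetas_relabel map_reshape wheels_relabel.
Qed.

Lemma theta_diagram_relabel j sh p q r :
  relabelling_invariant (theta_diagram j sh p q r).
Proof.
move=> pi [|u [|v s]] //=; rewrite -!map_drop -!map_take wheel_diagram_relabel.
by rewrite /theta !map_cat !map_chain_relabel !relabelE.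
Qed.

Lemma glue_wheel_val ts ws : ~~ odd (size ts) -> uniq (ts ++ flatten ws) ->
    size (ts ++ flatten ws) = k.*2 ->
  glue (thetas ts ++ wheels ws) = wheel_val (size ts)./2 (map size ws).
Proof.
move=> ets us ss; have ht := even_halfK ets.
rewrite /wheel_val -size_flatten ht -size_cat ss eqxx.
rewrite -(glue_invariant (@wheel_diagram_relabel _ _) us (enum_uniq V)) ?size_enum_ord //.
by rewrite /wheel_diagram ht take_size_cat // drop_size_cat // flattenK.
Qed.

Lemma glue_theta_val u v P Q R ts ws : ~~ odd (size ts) ->
    uniq ([:: u, v & P] ++ Q ++ R ++ ts ++ flatten ws) ->
    size ([:: u, v & P] ++ Q ++ R ++ ts ++ flatten ws) = k.*2 ->
  glue (theta u v P Q R ++ thetas ts ++ wheels ws) =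
  theta_val (size ts)./2 (map size ws) (size P) (size Q) (size R).
Proof.
move=> ets us ss; have ht := even_halfK ets.
rewrite /theta_val -size_flatten ht ifT; last first.
  by move: ss; rewrite /= !size_cat; lia.
rewrite -(glue_invariant (@theta_diagram_relabel _ _ _ _ _) us (enum_uniq V)) ?size_enum_ord //.
rewrite /= take_size_cat // !drop_size_cat // take_size_cat // take_size_cat //.
by rewrite /wheel_diagram ht take_size_cat // drop_size_cat // flattenK.
Qed.

Lemma ex_lists_of_sizes ns : sumn ns = k.*2 -> exists2 ss : seq (seq V),
  map size ss = ns & uniq (flatten ss).
Proof.
move=> sns; exists (reshape ns (enum V)).
  by apply: reshapeKl; rewrite size_enum_ord sns.
by rewrite reshapeKr ?enum_uniq // size_enum_ord sns.
Qed.

End DiagramValues.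

(** * The relations between values, in terms of the sizes alone *)

Section ValueRelations.
Variable k : nat.
Implicit Types (e phi : {perm halfedge k}) (h a b : halfedge k) (u v x y z : 'I_k.*2).
Implicit Types (E C : seq (halfedge k * halfedge k)) (xs P Q R ts s : seq 'I_k.*2).
Implicit Types (ws : seq (seq 'I_k.*2)) (sh : seq nat).

Lemma uniq_perm_eq (T : eqType) (s t : seq T) : uniq s -> perm_eq s t -> uniq t.
Proof. by move=> us /perm_uniq <-. Qed.

Lemma touched_vertices_wheel z xs : (z \in touched_vertices (wheel xs)) = (z \in xs).
Proof.
by case: xs => [|x xs] //; rewrite mem_touched_chain /= inE orbCA orbb orbC.
Qed.

Lemma touched_vertices_thetas z ts :
  z \in touched_vertices (thetas ts) -> z \in ts.
Proof.
have [n] := ubnP (size ts); elim: n ts => // n IH [|u [|v ts]] // lt_n.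
have -> : thetas [:: u, v & ts] = theta u v [::] [::] [::] ++ thetas ts by [].
rewrite touched_vertices_cat mem_cat => /orP[|/IH zts]; last first.
  by rewrite !inE zts ?orbT //; move: lt_n => /=; lia.
by rewrite /theta !touched_vertices_cat !mem_cat !mem_touched_chain /= !inE;
  case: (z == u); case: (z == v).
Qed.

Lemma touched_vertices_wheels z ws :
  (z \in touched_vertices (wheels ws)) = (z \in flatten ws).
Proof.
elim: ws => //= xs ws IH.
by rewrite /wheels /= touched_vertices_cat !mem_cat touched_vertices_wheel -IH.
Qed.

Lemma untouched_rest z ts ws : z \notin ts ++ flatten ws ->
  z \notin touched_vertices (thetas ts ++ wheels ws).
Proof.
apply: contra; rewrite touched_vertices_cat !mem_cat touched_vertices_wheels.
by case/orP => [/touched_vertices_thetas->|->]; rewrite ?orbT.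
Qed.

Lemma ex_theta_val j sh p q r : (j.*2.+2 + (p + q + r) + sumn sh == k.*2)%N ->
  exists u v P Q R ts ws,
   [/\ uniq ([:: u, v & P] ++ Q ++ R ++ ts ++ flatten ws),
       [/\ size P = p, size Q = q & size R = r], size ts = j.*2
     & map size ws = sh].
Proof.
move=> /eqP E.
have [|ss] := @ex_lists_of_sizes k ([:: 1; 1; p; q; r; j.*2] ++ sh)%N.
  by rewrite /= -E; lia.
case: ss => [|U [|W [|P [|Q [|R [|ts ws]]]]]] //= [sU sW sP sQ sR sts sws].
case: U W sU sW => [|u [|? ?]] // [|v [|? ?]] // _ _ us.
by exists u, v, P, Q, R, ts, ws.
Qed.

Lemma glue_theta_val' u v P Q R ts ws j sh p q r :
    uniq ([:: u, v & P] ++ Q ++ R ++ ts ++ flatten ws) ->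
    size P = p -> size Q = q -> size R = r -> size ts = j.*2 -> map size ws = sh ->
    (j.*2.+2 + (p + q + r) + sumn sh == k.*2)%N ->
  glue (theta u v P Q R ++ thetas ts ++ wheels ws) = theta_val k j sh p q r.
Proof.
move=> us sP sQ sR sts sws /eqP tot.
rewrite glue_theta_val // ?sts ?odd_double ?doubleK ?sP ?sQ ?sR ?sws //.
by rewrite /= !size_cat size_flatten [shape ws]sws sP sQ sR sts -tot; lia.
Qed.

Lemma theta_val_slide j sh p q r :
  theta_val k j sh p.+1 q r + theta_val k j sh p q.+1 r + theta_val k j sh p q r.+1 = 0.
Proof.
have [tot|tot] := boolP (j.*2.+2 + (p.+1 + q + r) + sumn sh == k.*2)%N; last first.
  by rewrite /theta_val !ifN ?addr0 //; lia.
have [u [v [[|x P] [Q [R [ts [ws [us [// sP sQ sR] sts sws]]]]]]]] := ex_theta_val tot.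
have [{}sP] := sP.
rewrite -(@glue_theta_val' u v (x :: P) Q R ts ws _ _ p.+1 q r) //; last by rewrite /= sP.
rewrite -(@glue_theta_val' u v P (x :: Q) R ts ws _ _ p q.+1 r) //; last first.
- by move: tot; lia.
- by rewrite /= sQ.
- apply: (uniq_perm_eq us); perm_count.
rewrite -(@glue_theta_val' u v P Q (x :: R) ts ws _ _ p q r.+1) //; last first.
- by move: tot; lia.
- by rewrite /= sR.
- apply: (uniq_perm_eq us); perm_count.
apply: glue_slide.
  move: us; rewrite /= !inE !negb_or; case/and4P.
  by move=> /and3P[-> -> _] /andP[-> _].
have uC : uniq (u :: x :: P ++ Q ++ R ++ ts ++ flatten ws).
  have : uniq (v :: u :: x :: P ++ Q ++ R ++ ts ++ flatten ws).
    by apply: (uniq_perm_eq us); perm_count.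
  by case/andP.
move: uC => /=; rewrite inE negb_or => /and3P[/andP[_ uN] xN _].
rewrite andbT; apply/andP; split.
  move: uN; rewrite !mem_cat !negb_or => /and5P[-> -> -> tN wN].
  by rewrite untouched_rest // mem_cat negb_or tN.
move: xN; rewrite !mem_cat !negb_or => /and5P[-> -> -> tN wN].
by rewrite untouched_rest // mem_cat negb_or tN.
Qed.

Lemma theta_val_cyclic j sh p q r : theta_val k j sh p q r = theta_val k j sh q r p.
Proof.
have [tot|tot] := boolP (j.*2.+2 + (p + q + r) + sumn sh == k.*2)%N; last first.
  by rewrite /theta_val !ifN //; lia.
have [u [v [P [Q [R [ts [ws [us [sP sQ sR] sts sws]]]]]]]] := ex_theta_val tot.
rewrite -(@glue_theta_val' u v P Q R ts ws) // -(@glue_theta_val' u v Q R P ts ws) //; last first.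
- by move: tot; lia.
- apply: (uniq_perm_eq us); perm_count.
move: us => /=; rewrite inE negb_or => /and3P[/andP[uv uN] vN _].
apply: glue_theta_cyclic => //; rewrite /= andbT; apply/andP; split.
  move: uN; rewrite !mem_cat !negb_or => /and5P[-> -> -> tN wN].
  by rewrite untouched_rest // mem_cat negb_or tN.
move: vN; rewrite !mem_cat !negb_or => /and5P[-> -> -> tN wN].
by rewrite untouched_rest // mem_cat negb_or tN.
Qed.

(** A theta graph without legs is one more copy of [Theta], at the head of [thetas]. *)
Lemma theta_val000 j sh : theta_val k j sh 0 0 0 = wheel_val k j.+1 sh.
Proof.
have [tot|tot] := boolP (j.*2.+2 + (0 + 0 + 0) + sumn sh == k.*2)%N; last first.
  by rewrite /wheel_val /theta_val !ifN // doubleS; lia.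
have [u [v [P [Q [R [ts [ws [us [sP sQ sR] sts sws]]]]]]]] := ex_theta_val tot.
rewrite -(@glue_theta_val' u v P Q R ts ws) //.
move: us; rewrite (size0nil sP) (size0nil sQ) (size0nil sR) /= => us.
rewrite -[RHS](_ : wheel_val k (size [:: u, v & ts])./2 (map size ws) = _); last first.
  by rewrite /= sts doubleK sws.
rewrite -glue_wheel_val //= ?sts ?odd_double //.
by rewrite size_cat sts size_flatten [shape ws]sws; move: tot; lia.
Qed.

Lemma perm_map_size (T : Type) (t : seq (seq T)) sh : perm_eq sh (map size t) ->
  exists2 Is, perm_eq Is (iota 0 (size t)) & map size (map (nth [::] t) Is) = sh.
Proof.
case/(perm_iotaP 0%N) => Is pIs ->; rewrite size_map in pIs.
exists Is => //; rewrite -map_comp; apply/eq_in_map => i.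
by rewrite (perm_mem pIs) mem_iota => /= lti; rewrite (nth_map [::]).
Qed.

Lemma perm_nth_iota (T : eqType) (x0 : T) (t : seq T) Is :
  perm_eq Is (iota 0 (size t)) -> perm_eq (map (nth x0 t) Is) t.
Proof. by move=> pIs; rewrite -[X in perm_eq _ X](mkseq_nth x0); apply: perm_map. Qed.

Lemma wheel_val_perm j sh sh' : perm_eq sh sh' -> wheel_val k j sh = wheel_val k j sh'.
Proof.
move=> pss; have [tot|tot] := boolP (j.*2 + sumn sh' == k.*2)%N; last first.
  by rewrite /wheel_val !ifN // (perm_sumn pss).
have [|[|ts ws] // [sts sws] us] := @ex_lists_of_sizes k (j.*2 :: sh').
  exact/eqP.
rewrite -sws in pss; have [Is /(perm_nth_iota [::]) pws <-] := perm_map_size pss.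
move: pws; set ws' := map _ _ => pws; rewrite -sws -[j]doubleK -sts.
have sz : size (ts ++ flatten ws) = k.*2.
  by rewrite size_cat sts size_flatten [shape ws]sws; apply/eqP.
have ets : ~~ odd (size ts) by rewrite sts odd_double.
have pf : perm_eq (ts ++ flatten ws) (ts ++ flatten ws').
  by rewrite perm_cat2l perm_flatten // perm_sym.
rewrite -glue_wheel_val // ?(perm_size pf) //; last first.
- by rewrite -(perm_size pf).
- exact: uniq_perm_eq pf.
rewrite -glue_wheel_val //; apply: perm_glue; rewrite perm_cat2l.
by apply: perm_flatten; apply: perm_map.
Qed.

Lemma theta_val_perm j sh sh' p q r : perm_eq sh sh' ->
  theta_val k j sh p q r = theta_val k j sh' p q r.
Proof.
move=> pss.
have [tot|tot] := boolP (j.*2.+2 + (p + q + r) + sumn sh' == k.*2)%N; last first.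
  by rewrite /theta_val !ifN // (perm_sumn pss).
have [u [v [P [Q [R [ts [ws [us [sP sQ sR] sts sws]]]]]]]] := ex_theta_val tot.
rewrite -sws in pss; have [Is /(perm_nth_iota [::]) pws ssh] := perm_map_size pss.
move: pws ssh; set ws' := map _ _ => pws ssh.
have pf : perm_eq (flatten ws) (flatten ws') by rewrite perm_flatten // perm_sym.
rewrite -(@glue_theta_val' u v P Q R ts ws j sh') // -(@glue_theta_val' u v P Q R ts ws' j sh) //.
- apply: perm_glue; rewrite !perm_cat2l.
  by apply: perm_flatten; apply: perm_map.
- by apply: (uniq_perm_eq us); rewrite !perm_cat2l.
by rewrite (perm_sumn pss) sws.
Qed.

End ValueRelations.

(** * Expansion along one spoke *)

Section JoiningSpokes.
Variable k : nat.
Local Notation V := 'I_k.*2.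
Implicit Types (e phi : {perm halfedge k}) (h a b : halfedge k) (u v x y z : 'I_k.*2).
Implicit Types (E C : seq (halfedge k * halfedge k)) (xs P Q R ts s : seq 'I_k.*2).
Implicit Types (ws : seq (seq 'I_k.*2)) (sh : seq nat).

Lemma touched_cat E C : touched (E ++ C) = touched E ++ touched C.
Proof. by rewrite /touched map_cat flatten_cat. Qed.

Lemma chain_cat a P y Q b : chain a (P ++ y :: Q) b = chain a P (prv y) ++ chain (nxt y) Q b.
Proof. by elim: P a => //= x P IH a; rewrite IH. Qed.

Lemma touched_chain a xs b h : (h \in touched (chain a xs b)) =
  [|| h == a, h == b | (h.1 \in xs) && (h.2 != spoke)].
Proof.
elim: xs a => [|x xs IH] a; first by rewrite !inE orbF.
have -> : touched (chain a (x :: xs) b) = a :: prv x :: touched (chain (nxt x) xs b) by [].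
rewrite !inE IH.
clear IH; case: h => v; apply: I3P; rewrite /= !xpair_eqE ?andbT ?andbF ?orbF //=.
all: by case: (_ == a); case: (_ == b); case: (v == x); case: (v \in xs).
Qed.

Lemma touched_wheels ws h :
  (h \in touched (wheels ws)) = (h.1 \in flatten ws) && (h.2 != spoke).
Proof.
elim: ws => //= -[|x xs] ws IH //.
rewrite /wheels /= -/(wheels ws) touched_cat mem_cat IH touched_chain inE mem_cat.
clear IH; case: h => v; apply: I3P; rewrite /= !xpair_eqE ?andbT ?andbF ?orbF //=.
all: by case: (v == x); case: (v \in xs).
Qed.

Lemma touched_thetas ts v i : ~~ odd (size ts) -> v \in ts -> (v, i) \in touched (thetas ts).
Proof.
have [n] := ubnP (size ts); elim: n ts => // n IH [|u [|w ts]] // lt_n ev.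
have -> : thetas [:: u, w & ts] = theta u w [::] [::] [::] ++ thetas ts by [].
rewrite touched_cat mem_cat !inE orbA => /orP[|vts]; last first.
  by rewrite IH ?orbT //; move: lt_n ev => /=; [lia|rewrite negbK].
rewrite /= !xpair_eqE => uw.
by clear IH; move: i; apply: I3P; rewrite ?andbT ?andbF ?orbF /=; case/orP: uw => ->; rewrite ?orbT.
Qed.

(** The diagram uses every vertex, so the only half-edges still free are spokes. All other partners
    of [spk x], and [spk x] itself, contribute 0. *)
Lemma glue_expand_spoke ts x P ws : ~~ odd (size ts) ->
    uniq (ts ++ (x :: P) ++ flatten ws) -> size (ts ++ (x :: P) ++ flatten ws) = k.*2 ->
    let E := thetas ts ++ wheels ((x :: P) :: ws) in
  glue E = \sum_(y <- P ++ flatten ws) glue ((spk x, spk y) :: E).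
Proof.
move=> ets us ss E; have in_s v : v \in ts ++ (x :: P) ++ flatten ws := mem_uniq_full v us ss.
have xts : x \notin ts.
  have : uniq (x :: ts ++ P ++ flatten ws) by apply: (uniq_perm_eq us); perm_count.
  by rewrite /= mem_cat negb_or -andbA => /and3P[].
have xE : spk x \notin touched E.
  rewrite touched_cat mem_cat touched_wheels andbF orbF; apply: contra xts => xE.
  by apply: touched_vertices_thetas; apply/mapP; exists (spk x).
have tE v i : (v \in ts) || (i != spoke) -> (v, i) \in touched E.
  rewrite touched_cat mem_cat; have [vts _|vts /= i_n] := boolP (v \in ts).
    by rewrite touched_thetas.
  rewrite touched_wheels /= i_n andbT; have := in_s v.
  by rewrite mem_cat (negbTE vts) /= => ->; rewrite orbT.
rewrite [LHS](glue_expand (spk x)).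
transitivity (\sum_(v : V) \sum_(i : 'I_3) glue ((spk x, (v, i)) :: E)).
  by rewrite pair_bigA; apply: eq_bigr => -[].
transitivity (\sum_(v <- enum V) glue ((spk x, spk v) :: E)).
  rewrite big_enum /=; apply: eq_bigr => v _; rewrite (bigD1 spoke) //= big1 ?addr0 //.
  by move=> i i_n; rewrite glue_touched // tE // i_n orbT.
rewrite (perm_big (ts ++ (x :: P) ++ flatten ws)) /=; last first.
  apply: uniq_perm => //; first exact: enum_uniq.
  by move=> v; rewrite mem_enum in_s.
rewrite big_cat big_cons /= glue_loop add0r big_seq big1 ?add0r // => v vts.
by rewrite glue_touched // tE // vts.
Qed.

Lemma all_untouched s t ts ws : uniq (s ++ t ++ ts ++ flatten ws) ->
  all (fun z => z \notin t ++ touched_vertices (thetas ts ++ wheels ws)) s.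
Proof.
rewrite cat_uniq => /and3P[_ /hasPn sN _]; apply/allP => z zs.
have : z \notin t ++ ts ++ flatten ws by apply: contraL zs => /sN.
rewrite !mem_cat !negb_or -negb_or -mem_cat => /andP[-> zN].
by rewrite untouched_rest.
Qed.

Lemma join_same_val x y P1 P2 ts ws j sh n i :
    uniq (ts ++ (x :: P1 ++ y :: P2) ++ flatten ws) ->
    size ts = j.*2 -> map size ws = sh -> size P1 = i -> size (P1 ++ y :: P2) = n ->
    (j.*2 + (n.+1 + sumn sh) == k.*2)%N ->
  glue ((spk x, spk y) :: thetas ts ++ wheels ((x :: P1 ++ y :: P2) :: ws)) =
  (-1) ^+ (n.-1 - i) *: theta_val k j sh i (n.-1 - i) 0.
Proof.
move=> us sts sws sP1 sn tot.
have sP2 : size P2 = (n.-1 - i)%N by move: sn; rewrite size_cat sP1 /= => <-; lia.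
have us' : uniq ([:: x; y] ++ (P1 ++ P2) ++ ts ++ flatten ws).
  by apply: (uniq_perm_eq us); perm_count.
have us2 : uniq (P2 ++ P1 ++ ts ++ flatten ws).
  have : uniq ([:: x; y] ++ (P2 ++ P1 ++ ts ++ flatten ws)).
    by apply: (uniq_perm_eq us); perm_count.
  by rewrite cat_uniq => /and3P[].
rewrite (perm_glue (C := (spk x, spk y) :: chain (nxt x) P1 (prv y)
  ++ chain (nxt y) P2 (prv x) ++ (thetas ts ++ wheels ws))); last first.
  by rewrite /wheels /= chain_cat; perm_count.
rewrite glue_join_same; last first.
- by rewrite has_notin; apply: all_untouched.
- by rewrite catA; apply: all_untouched.
- by move: us2; rewrite cat_uniq => /andP[].
- by move: us' => /=; rewrite inE negb_or => /andP[/andP[]].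
rewrite -sP2; congr (_ *: _); apply: glue_theta_val' => //.
- by apply: (uniq_perm_eq us'); perm_count.
- by rewrite size_rev.
by move: tot sn; rewrite -sP1 size_cat /=; lia.
Qed.

(** The edge list of a wheel is cyclic and may be cut open at any rim vertex. *)
Lemma perm_wheel_rot Q1 y Q2 :
  perm_eq (wheel (Q1 ++ y :: Q2)) (chain (nxt y) (Q2 ++ Q1) (prv y)).
Proof.
case: Q1 => [|q Q1]; first by rewrite cats0.
by rewrite /= !chain_cat perm_catC.
Qed.

(** The second wheel is even, so [m.-1] of its legs remain, an odd number. Both terms of
    [glue_join_distinct] then have sign $-1$, and having the same sizes they have the same value. *)
Lemma join_distinct_val x y P ts A Q1 Q2 B j sh n m :
    uniq (ts ++ (x :: P) ++ flatten (A ++ (Q1 ++ y :: Q2) :: B)) ->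
    size ts = j.*2 -> map size (A ++ B) = sh -> size P = n ->
    size (Q1 ++ y :: Q2) = m -> ~~ odd m ->
    (j.*2 + (n.+1 + (m + sumn sh)) == k.*2)%N ->
  glue ((spk x, spk y) :: thetas ts
          ++ wheels ((x :: P) :: (A ++ (Q1 ++ y :: Q2) :: B))) =
  - (2%:R *: theta_val k j sh n m.-1 0).
Proof.
move=> us sts sws sP sm em tot.
have sQ : size (Q2 ++ Q1) = m.-1 by rewrite -sm !size_cat /= addnS addnC.
have us' : uniq ([:: x; y] ++ (P ++ Q2 ++ Q1) ++ ts ++ flatten (A ++ B)).
  by apply: (uniq_perm_eq us); perm_count.
have us2 : uniq ((Q2 ++ Q1) ++ P ++ ts ++ flatten (A ++ B)).
  have : uniq ([:: x; y] ++ ((Q2 ++ Q1) ++ P ++ ts ++ flatten (A ++ B))).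
    by apply: (uniq_perm_eq us); perm_count.
  by rewrite cat_uniq => /and3P[].
rewrite (perm_glue (C := (spk x, spk y) :: chain (nxt x) P (prv x)
  ++ chain (nxt y) (Q2 ++ Q1) (prv y) ++ (thetas ts ++ wheels (A ++ B)))); last first.
  have /seq.permP cw := perm_wheel_rot Q1 y Q2.
  by apply/seq.permP => p; rewrite /wheels; count_simp; rewrite cw; count_lia.
rewrite glue_join_distinct; last first.
- by rewrite has_notin; apply: all_untouched.
- by rewrite catA; apply: all_untouched.
- by move: us2; rewrite cat_uniq => /andP[].
- by move: us' => /=; rewrite inE negb_or => /andP[/andP[]].
have m_gt0 : (0 < m)%N by rewrite -sm size_cat addnS.
have tot' : (j.*2.+2 + (n + m.-1 + 0) + sumn sh == k.*2)%N by move: tot; lia.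
rewrite sQ -signr_odd (_ : odd m.-1); last by rewrite -[odd _]negbK -oddS prednK.
rewrite expr1 scaleN1r.
rewrite (@glue_theta_val' _ x y P (rev (Q2 ++ Q1)) [::] ts (A ++ B) j sh n m.-1 0) //; last first.
- by rewrite size_rev.
- by apply: (uniq_perm_eq us'); perm_count.
rewrite (@glue_theta_val' _ y x P (Q2 ++ Q1) [::] ts (A ++ B) j sh n m.-1 0) //; last first.
- by apply: (uniq_perm_eq us'); perm_count.
by rewrite -opprD -[X in X + X]scale1r -scalerDl.
Qed.

(** In the first sum the partner lies on the same wheel, with [i] legs on one side of the chord. In
    the second it is any of the $m$ spokes of the [l]-th other wheel, each contributing $-2$ times
    the same theta graph; hence the coefficient $2m$. *)
Lemma wheel_val_expand j n sh : odd n -> all (fun m => ~~ odd m) sh ->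
  wheel_val k j (n.+1 :: sh) =
  \sum_(i < n) (-1) ^+ (n.-1 - i) *: theta_val k j sh i (n.-1 - i) 0
  - \sum_(l < size sh) (2 * nth 0%N sh l)%:R *:
      theta_val k j (take l sh ++ drop l.+1 sh) n (nth 0%N sh l).-1 0.
Proof.
move=> on esh.
have sum_sh l : (l < size sh)%N ->
    (sumn sh = nth 0%N sh l + sumn (take l sh ++ drop l.+1 sh))%N.
  move=> lt_l; rewrite -{1}(cat_take_drop l sh) (drop_nth 0%N lt_l) !sumn_cat /=.
  by rewrite addnCA.
have [tot|tot] := boolP (j.*2 + (n.+1 + sumn sh) == k.*2)%N; last first.
  rewrite {1}/wheel_val /= ifN // big1; last first.
    by move=> i _; rewrite /theta_val ifN ?scaler0 //; move: tot (ltn_ord i); lia.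
  (* An empty wheel is set apart because [0.-1 = 0] would spoil the vertex count; its coefficient is
     0. *)
  rewrite big1 ?subr0 // => l _; have [->|] := posnP (nth 0%N sh l); first by rewrite muln0 scale0r.
  move=> m_gt0; rewrite /theta_val ifN ?scaler0 //.
  by move: tot (sum_sh _ (ltn_ord l)); lia.
have [|[|ts [|[|x P] ws]] // [sts [sP] sws] us] := @ex_lists_of_sizes k [:: j.*2, n.+1 & sh].
  exact/eqP.
have {}us : uniq (ts ++ (x :: P) ++ flatten ws) := us.
have ss : size (ts ++ (x :: P) ++ flatten ws) = k.*2.
  by move: tot; rewrite !size_cat /= sP sts size_flatten [shape ws]sws; lia.
have ets : ~~ odd (size ts) by rewrite sts odd_double.
rewrite -[LHS](_ : wheel_val k (size ts)./2 (map size ((x :: P) :: ws)) = _); last first.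
  by rewrite /= sP sws sts doubleK.
rewrite -glue_wheel_val // glue_expand_spoke // big_cat /=; congr (_ + _).
  rewrite (big_nth x) big_mkord sP; apply: eq_bigr => i _.
  have lti : (i < size P)%N by rewrite sP.
  have eP : P = take i P ++ nth x P i :: drop i.+1 P.
    by rewrite -drop_nth // cat_take_drop.
  rewrite [X in (x :: X) :: ws]eP.
  apply: (@join_same_val _ _ _ _ ts ws j sh n) => //.
  - by rewrite -eP.
  - by rewrite size_takel // ltnW.
  - by rewrite -eP.
rewrite big_flatten /= (big_nth [::]) big_mkord -sumrN.
rewrite -sws size_map; apply: eq_bigr => l _; rewrite -map_take -map_drop.
rewrite (nth_map [::]) //.
have lsh : (l < size sh)%N by rewrite -sws size_map.
set w := nth _ ws l; have ew : ws = take l ws ++ w :: drop l.+1 ws.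
  by rewrite -drop_nth // cat_take_drop.
rewrite (eq_big_seq (fun => - (2%:R *: theta_val k j
    (map size (take l ws) ++ map size (drop l.+1 ws)) n (size w).-1 0))) => [|y yw].
  rewrite big_const_seq count_predT iter_addr addr0 mulNrn.
  by rewrite -scaler_nat scalerA -natrM mulnC.
have [Q1 [Q2 ew12]] : exists Q1 Q2, w = Q1 ++ y :: Q2.
  by case/splitPr: yw => Q1 Q2; exists Q1, Q2.
rewrite [in LHS]ew ew12; apply: join_distinct_val => //.
- by rewrite -ew12 -ew.
- by rewrite map_cat.
- rewrite -ew12; move/allP: esh; apply; rewrite -sws; apply: map_f; exact: mem_nth.
move: tot (sum_sh l lsh); rewrite -sws -map_take -map_drop (nth_map [::]) // -/w ew12; lia.
Qed.

End JoiningSpokes.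

(** * Theta graphs and polywheels as values *)

Section ClosedGraphs.
Variable k : nat.
Local Notation V := 'I_k.*2.
Implicit Types (e phi : {perm halfedge k}) (h a b : halfedge k) (u v x y z : 'I_k.*2).
Implicit Types (E C : seq (halfedge k * halfedge k)) (xs P Q R ts s : seq 'I_k.*2).
Implicit Types (ws : seq (seq 'I_k.*2)) (sh : seq nat).

Lemma edge_class_val (G : tgraph k) : vrot G = std_rot k -> edge_class (edge G) = gclass G.
Proof.
rewrite /edge_class /rot_class /edge => <-.
rewrite (_ : (vrot G, _) = val G); last by rewrite /vrot -surjective_pairing.
by rewrite valK.
Qed.

Lemma fpf_inv_edge (G : tgraph k) : fpf_inv (edge G).
Proof.
apply/forallP => h; rewrite /edge; case: G => -[r e] /= /forallP/(_ h) /=.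
by case/and4P => _ _ -> ->.
Qed.

(** Only fixed-point free involutions contribute to [glue], and these are exactly the edge
    permutations of the graphs with rotation [std_rot]. *)
Lemma glue_graphs E :
  glue E = \sum_(G : tgraph k | (vrot G == std_rot k) && agrees (edge G) E) gclass G.
Proof.
rewrite /glue (bigID (@fpf_inv k)) /= addrC big1 ?add0r; last first.
  by move=> e /andP[_ /edge_class_invalid].
(* Here [theta_graph k] is merely a default value, for the [e] that give no graph. *)
pose toG e : tgraph k := insubd (theta_graph k) (std_rot k, e).
have toGK e : fpf_inv e -> tgraph_val (toG e) = (std_rot k, e).
  move=> fe; have vt : is_tgraph (std_rot k, e).
    by rewrite (is_tgraph_fibre _ (@std_rot_fibre k)).
  exact: insubdK vt.
rewrite (reindex_onto (@edge k) toG) /=; last first.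
  by move=> e /andP[_ fe]; rewrite /edge toGK.
have toGE (G : tgraph k) : (toG (edge G) == G) = (vrot G == std_rot k).
  rewrite -val_eqE /= toGK ?fpf_inv_edge // [RHS]eq_sym /vrot /edge.
  by case: (tgraph_val G) => r e; rewrite xpair_eqE eqxx andbT.
apply: eq_big => G; rewrite toGE fpf_inv_edge andbT; first by rewrite andbC.
by case/andP => _ /eqP vG; rewrite edge_class_val.
Qed.

Lemma agrees_cat e E C : agrees e (E ++ C) = agrees e E && agrees e C.
Proof. exact: all_cat. Qed.

Lemma agrees_thetas e x0 s : ~~ odd (size s) ->
  reflect (forall i l, (i < (size s)./2)%N ->
             e (nth x0 s i.*2, l) = (nth x0 s i.*2.+1, rev_ord l))
          (agrees e (thetas s)).
Proof.
have [n] := ubnP (size s); elim: n s => // n IH [|u [|v s]] // lt_n ev.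
  by apply: (iffP idP) => // _ i l.
have -> : thetas [:: u, v & s] = theta u v [::] [::] [::] ++ thetas s by [].
have {}IH : reflect (forall i l, (i < (size s)./2)%N ->
             e (nth x0 s i.*2, l) = (nth x0 s i.*2.+1, rev_ord l)) (agrees e (thetas s)).
  by apply: IH; [move: lt_n => /=; lia|move: ev; rewrite /= negbK].
rewrite agrees_cat; apply: (iffP andP) => [[uv /IH IHs] [|i] l lti|H].
- move: uv; rewrite /= andbT => /and3P[/eqP e0 /eqP e1 /eqP e2].
  by move: l; apply: I3P; rewrite ?e0 ?e1 ?e2; congr pair; apply: val_inj.
- by rewrite doubleS /= IHs.
split.
  have /= Hl l := H 0%N l isT; rewrite !Hl andbT; apply/and3P.
  by split; apply/eqP; congr pair; apply: val_inj.
by apply/IH => i l lti; rewrite -(H i.+1 l).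
Qed.

(** With [k] copies of [Theta] no half-edge is free, so the sum of graphs has a single term. *)
Lemma theta_graph_val : gclass (theta_graph k) = wheel_val k k [::].
Proof.
rewrite /wheel_val addn0 eqxx /wheel_diagram take_oversize ?size_enum_ord // cats0.
rewrite glue_graphs (big_pred1 (theta_graph k)) // => G.
have e_size : ~~ odd (size (enum V)) by rewrite size_enum_ord odd_double.
have nE (x0 : V) i : (i < k.*2)%N -> nat_of_ord (nth x0 (enum V) i) = i := @nth_enum_ord _ _ _.
apply/andP/eqP => [[/eqP vG ag]|->].
  apply: val_inj; rewrite /= [LHS]surjective_pairing; congr pair; first exact: vG.
  apply/permP => -[v l]; rewrite permE /theta_edge_fun /=.
  have H := elimT (agrees_thetas (edge G) v e_size) ag.
  (* The edge list prescribes the images of the half-edges at even vertices; those at odd vertices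
     follow because [edge G] is an involution. *)
  have key (w : V) m : ~~ odd w -> edge G (w, m) = (theta_mate w, rev_ord m).
    move=> ew; have dw := even_halfK ew; have lw := ltn_ord w.
    have := H w./2 m; rewrite size_enum_ord doubleK => H'.
    rewrite (_ : w = nth v (enum V) w./2.*2) ?H'; last 1 first.
    - by apply: val_inj; rewrite /= nE dw.
    - congr pair; apply: val_inj; rewrite /= nE ?dw //.
        by rewrite nE ?dw // /theta_mate_nat (negbTE ew).
      by move: ew lw; lia.
    by move: ew lw; lia.
  have [ov|ev] := boolP (odd v); last exact: key.
  have em : ~~ odd (theta_mate v).
    by rewrite /= /theta_mate_nat ov; case: (nat_of_ord v) ov.
  have := key _ (rev_ord l) em; rewrite theta_mateK rev_ordK => <-.
  by have /andP[_ /eqP] := forallP (fpf_inv_edge G) (theta_mate v, rev_ord l).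
split; first exact: eqxx.
have [->|k_gt0] := posnP k; first by rewrite enum_ord0.
have x0 : V by apply: Ordinal (_ : 0 < k.*2)%N; rewrite double_gt0.
apply/(agrees_thetas _ x0 e_size) => i l; rewrite size_enum_ord doubleK => lti.
rewrite /edge /= permE /theta_edge_fun /=; congr pair; apply: val_inj => /=.
by rewrite !nE /theta_mate_nat ?odd_double //; lia.
Qed.

Lemma agrees_chain e x0 x xs b : reflect
  ((forall i, (i < size xs)%N -> e (nxt (nth x0 (x :: xs) i)) = prv (nth x0 xs i)) /\
     e (nxt (last x xs)) = b)
  (agrees e (chain (nxt x) xs b)).
Proof.
elim: xs x => [|y xs IH] x /=; first by rewrite andbT; apply: (iffP eqP) => [|[]].
apply: (iffP andP) => [[/eqP exy /IH[H lE]]|[H lE]].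
  by split=> // -[|i] //= lti; apply: H.
by split; [apply/eqP; apply: (H 0%N)|apply/IH; split=> // i; apply: (H i.+1)].
Qed.

Lemma agrees_wheel e x0 xs : reflect
  (forall i, (i < size xs)%N -> e (nxt (nth x0 xs i)) = prv (nth x0 xs (i.+1 %% size xs)))
  (agrees e (wheel xs)).
Proof.
case: xs => [|x xs]; first by apply: ReflectT.
apply: (iffP (agrees_chain e x0 x xs (prv x))) => [[H lE] i lti|H]; last first.
  split=> [i lti|]; first by rewrite H /= ?modn_small //; lia.
  by rewrite (last_nth x0) H //= modnn.
have [lti'|] := ltnP i (size xs); first by rewrite H // modn_small //= ltnS.
move=> gei; have -> : i = size xs by apply/eqP; rewrite eqn_leq gei andbT -ltnS.
by rewrite /= modnn -(last_nth x0) lE.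
Qed.

Lemma agrees_wheels e ws : reflect
  (forall r, (r < size ws)%N -> agrees e (wheel (nth [::] ws r)))
  (agrees e (wheels ws)).
Proof.
elim: ws => [|xs ws IH]; first by apply: ReflectT.
rewrite /wheels /= agrees_cat; apply: (iffP andP) => [[exs /IH H] [|r] //|H].
  by apply: H.
by split; [exact: (H 0%N)|apply/IH => r; exact: (H r.+1)].
Qed.

(** Both sides sum over graphs with rotation [std_rot]. The edge list only fixes the rims, whereas
    [joins_wheels] also asks that spokes be joined to spokes; that this follows is the point of the
    proof. *)
Lemma polywheel_val (lam : intpart k.*2) : polywheel lam = wheel_val k 0 (parts lam).
Proof.
have sum_lam : sumn (parts lam) = k.*2.
  by rewrite /parts; case: lam => p /= /and3P[_ _ /eqP].
rewrite /wheel_val sum_lam eqxx /wheel_diagram take0 drop0 /= glue_graphs.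
rewrite /polywheel; apply: eq_bigl => G; rewrite /joins_wheels.
have [vG|//] := eqVneq (vrot G) (std_rot k); rewrite /=.
set sh := parts lam in sum_lam *.
have nE (x0 : V) i : (i < k.*2)%N -> nat_of_ord (nth x0 (enum V) i) = i := @nth_enum_ord _ _ _.
have nthE x0 r i : (i < nth 0%N sh r)%N ->
    nat_of_ord (nth x0 (nth [::] (reshape sh (enum V)) r) i) = flatten_index sh r i.
  move=> lti; rewrite nth_reshape nth_take // nth_drop nE //.
  by rewrite -sum_lam; apply: flatten_indexP.
have size_nth r : (r < size sh)%N -> size (nth [::] (reshape sh (enum V)) r) = nth 0%N sh r.
  move=> ltr; rewrite -[in RHS](@reshapeKl _ sh (enum V)) ?size_enum_ord ?sum_lam //.
  by rewrite (nth_map [::]) // size_reshape.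
have part_gt0 r : (r < size sh)%N -> (0 < nth 0%N sh r)%N.
  move=> ltr; rewrite lt0n; have : 0%N \notin sh.
    by rewrite /sh /parts; case: lam {sh sum_lam nE nthE size_nth ltr} => p /= /and3P[].
  by apply: contraNneq => <-; apply: mem_nth.
apply/forallP/agrees_wheels => [H r | H v].
  rewrite size_reshape => ltr; case Er : (nth [::] _ r) => [|x0 xs] //; rewrite -Er.
  apply/(agrees_wheel (edge G) x0) => i; rewrite size_nth // => lti.
  set w := nth x0 _ i; have /and3P[/eqP e1 /eqP e2 _] := H w.
  rewrite [LHS]surjective_pairing e2; congr pair; apply: val_inj => /=.
  have ew : nat_of_ord w = flatten_index sh r i := nthE _ _ _ lti.
  rewrite e1 /wheel_next ew flatten_indexKl // flatten_indexKr //.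
  by rewrite nthE // ltn_pmod // part_gt0.
have ltv := ltn_ord v.
have eP (w : V) : (edge G (nxt w)).1 = wheel_next sh w :> nat /\ (edge G (nxt w)).2 = rim_prev.
  have ltw : (w < sumn sh)%N by rewrite sum_lam.
  have ltr := reshape_indexP ltw; have lto := reshape_offsetP ltw.
  have := H _ _; rewrite size_reshape => /(_ _ ltr) /(agrees_wheel _ w).
  move=> /(_ (reshape_offset sh w)); rewrite size_nth // => /(_ lto).
  rewrite (_ : nth w _ (reshape_offset sh w) = w) => [->|]; last first.
    by apply: val_inj; rewrite /= nthE // reshape_indexK.
  by split=> //=; rewrite nthE // ltn_pmod // part_gt0.
have [e1 e2] := eP v; rewrite e1 e2 !eqxx /=.
have next_inj : injective (fun w : V => (edge G (nxt w)).1).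
  move=> w w' E; have [_ ew] := eP w; have [_ ew'] := eP w'.
  have : edge G (nxt w) = edge G (nxt w').
    by rewrite [LHS]surjective_pairing [RHS]surjective_pairing ew ew' E.
  by move=> /perm_inj[].
have eK h : edge G (edge G h) = h.
  by have /andP[_ /eqP] := forallP (fpf_inv_edge G) h.
(* A spoke cannot end on the rim: [next_inj] on a finite set is a bijection, so each [rim_prev] is
   already the mate of some [rim_next], and each [rim_next] has a [rim_prev] as its mate. *)
case E : (edge G (spk v)) => [w m] /=; move: m E; apply: I3P => // E.
  have [g _ gK] := injF_bij next_inj; have [_ e2'] := eP (g w).
  have : edge G (nxt (g w)) = edge G (spk v).
    by rewrite E [LHS]surjective_pairing gK e2'.
  by move=> /perm_inj[].
by have := eK (spk v); rewrite E => Ew; have [_] := eP w; rewrite Ew.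
Qed.

End ClosedGraphs.

(** * The power series *)

Section Truncation.
Variable R : comNzRingType.
Implicit Types p q : {poly R}.

(** $p = O(x^M)$: identities of power series are stated for truncations modulo $x^M$. *)
Definition vanish M p := exists q, p = 'X^M * q.

Lemma vanishP M p : (forall i, (i < M)%N -> p`_i = 0) <-> vanish M p.
Proof.
split=> [p0|[q ->] i ltiM]; last by rewrite coefXnM ltiM.
exists (drop_poly M p); rewrite -{1}(poly_take_drop M p) (_ : take_poly M p = 0) ?add0r 1?mulrC //.
by apply/polyP => i; rewrite coef_take_poly coef0; case: ifP => // /p0.
Qed.

Lemma vanishD M p q : vanish M p -> vanish M q -> vanish M (p + q).
Proof. by move=> [p' ->] [q' ->]; exists (p' + q'); rewrite mulrDr. Qed.

Lemma vanishM M p q : vanish M p -> vanish M (p * q).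
Proof. by move=> [p' ->]; exists (p' * q); rewrite mulrA. Qed.

Lemma vanishMl M p q : vanish M p -> vanish M (q * p).
Proof. by rewrite mulrC; apply: vanishM. Qed.

Lemma vanishN M p : vanish M p -> vanish M (- p).
Proof. by move=> [p' ->]; exists (- p'); rewrite mulrN. Qed.

Lemma vanish_le M M' p : (M' <= M)%N -> vanish M p -> vanish M' p.
Proof.
move=> le_M /vanishP p0; apply/vanishP => i lti; apply: p0; exact: leq_trans le_M.
Qed.

Lemma vanish_sum M (I : Type) (r : seq I) (P : pred I) (F : I -> {poly R}) :
  (forall i, P i -> vanish M (F i)) -> vanish M (\sum_(i <- r | P i) F i).
Proof.
move=> H; apply: (big_ind (vanish M)) => //; last exact: vanishD.
by exists 0; rewrite mulr0.
Qed.

Lemma vanishX M n p : vanish M p -> vanish (M * n) (p ^+ n).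
Proof. by move=> [q ->]; exists (q ^+ n); rewrite exprMn -exprM. Qed.

Lemma coef_comp_scaleX p (a : R) i : (p \Po (a *: 'X))`_i = p`_i * a ^+ i.
Proof.
rewrite comp_polyE coef_sum.
under eq_bigr => j _ do rewrite exprZn !coefZ coefXn.
have [lti|gei] := ltnP i (size p).
  rewrite (bigD1 (Ordinal lti)) //= eqxx mulr1 big1 ?addr0 // => j ij.
  by rewrite (_ : (i == j) = false) ?mulr0 //; apply: negbTE; rewrite eq_sym.
rewrite nth_default // mul0r big1 // => j _.
by rewrite (_ : (i == j) = false) ?mulr0 //; have := ltn_ord j; lia.
Qed.

End Truncation.

(** * The logarithmic derivative of sinh(x/2)/(x/2) *)

Section LogDerivative.
Implicit Types (m n i j N : nat).

Lemma coef_sinhc_half N i :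
  (sinhc_half N)`_i = if odd i || (N.*2 < i)%N then 0 else (2%:R ^+ i * (i.+1)`!%:R)^-1.
Proof.
rewrite /sinhc_half coef_sum.
under eq_bigr => j _ do rewrite coefZ coefXn.
have [oi|ei] := boolP (odd i) => /=.
  rewrite big1 // => j _; rewrite (_ : (i == _) = false) ?mulr0 //.
  by apply: contraTF oi => /eqP->; rewrite odd_double.
case: ltnP => [lti|gei].
  rewrite big1 // => j _; rewrite (_ : (i == _) = false) ?mulr0 //.
  by have := ltn_ord j; lia.
have hi := even_halfK ei; have lth : (i./2 < N.+1)%N by lia.
rewrite (bigD1 (Ordinal lth)) //= hi eqxx mulr1 big1 ?addr0 // => j ij.
rewrite (_ : (i == _) = false) ?mulr0 //; apply: contraNF ij => /eqP E.
by rewrite -val_eqE /= E doubleK.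
Qed.

Lemma vanish_sinhc_half_sub1 N : vanish 2 (sinhc_half N - 1).
Proof.
apply/vanishP => -[|[|//]] _; rewrite coefB coef_sinhc_half coef1 /=.
  by rewrite expr0 mul1r (_ : 1`!%N = 1%N) // invr1 subrr.
by rewrite subrr.
Qed.

(** For the full series, $xf = 2\sinh(x/2)$ satisfies $(xf)'' = xf/4$, and $(xf)'' = xf'' + 2f'$. *)
Lemma sinhc_half_ode N : let f := sinhc_half N in
  vanish N.*2 ('X * f^`()^`() + 2%:R *: f^`() - 4%:R^-1 *: ('X * f)).
Proof.
move=> f; apply/vanishP => i lti.
rewrite !(coefD, coefN, coefZ, coefXM, coef_deriv) /=.
case: i lti => [|i] lti /=.
  by rewrite coef_sinhc_half /= mulr1n mulr0 subr0 addr0.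
rewrite !coef_sinhc_half /= negbK.
have [oi|ei] := boolP (odd i) => /=.
  by rewrite !mul0rn !mulr0 subr0 addr0.
rewrite !ifN; [|by rewrite -leqNgt; lia..].
have -> : (i.+3`!%:R : rat) = i.+3%:R * i.+2%:R * i.+1`!%:R.
  by rewrite -!natrM -mulnA -!factS.
have nzF : i.+1`!%:R != 0 :> rat by rewrite pnatr_eq0 -lt0n fact_gt0.
have nzP : 2%:R ^+ i != 0 :> rat by rewrite expf_neq0.
have -> : 2%:R ^+ i.+2 = 4%:R * 2%:R ^+ i :> rat by rewrite !exprS mulrA -natrM.
move: (i.+1`!%:R : rat) (2%:R ^+ i : rat) nzF nzP => F P nzF nzP.
have n2 : i%:R + 2%:R != 0 :> rat by rewrite -natrD pnatr_eq0 addn2.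
have n3 : i%:R + 3%:R != 0 :> rat by rewrite -natrD pnatr_eq0 addn3.
have e3 : i.+3%:R = i%:R + 3%:R :> rat by rewrite -natrD addn3.
have e2 : i.+2%:R = i%:R + 2%:R :> rat by rewrite -natrD addn2.
have e1 : i.+1%:R = i%:R + 1 :> rat by rewrite -natr1.
rewrite -(mulr_natr _ i.+2) -(mulr_natr _ i.+1) e3 e2 e1.
by field; rewrite nzF nzP n2 n3.
Qed.

Definition log_sinhc N := log_trunc N (sinhc_half N).

(** A truncation of $f'/f = \coth(x/2)/2 - 1/x$ for $f = \sinh(x/2)/(x/2)$. *)
Definition dlog N := (log_sinhc N)^`().

(** The derivative of the truncated logarithm is the geometric sum $\sum_{i<N}(1-f)^i f'$.
    Multiplied by $f$ it telescopes to $(1-(1-f)^N)f'$, and $1-f = O(x^2)$. *)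
Lemma vanish_dlog N : let f := sinhc_half N in vanish N.*2 (f * dlog N - f^`()).
Proof.
move=> f; have du : (f - 1)^`() = f^`() by rewrite derivB -polyC1 derivC subr0.
have -> : dlog N = (\sum_(i < N) (1 - f) ^+ i) * f^`().
  rewrite /dlog /log_sinhc /log_trunc -/f big_add1 big_mkord /= raddf_sum /= mulr_suml.
  apply: eq_bigr => i _; rewrite derivZ deriv_exp du /= -scaler_nat scalerA.
  rewrite divfK ?pnatr_eq0 // -[1 - f]opprB [in RHS]exprNn.
  rewrite [(-1) ^+ _ : rat]exprS [(-1) ^+ _ : rat]exprS !mulN1r opprK.
  rewrite -[(-1) ^+ i : rat]signr_odd -[(-1) ^+ i : {poly rat}]signr_odd.
  by case: odd; rewrite /= ?expr1 ?expr0 ?scaleN1r ?scale1r ?mulN1r ?mul1r ?mulNr mulrC.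
rewrite mulrA -[X in _ - X]mul1r -mulrBl; apply: vanishM.
have -> : f * (\sum_(i < N) (1 - f) ^+ i) = 1 - (1 - f) ^+ N.
  have := subrXX 1 (1 - f) N; rewrite expr1n => ->; congr (_ * _).
    by rewrite opprB addrC subrK.
  by apply: eq_bigr => i _; rewrite expr1n mul1r.
rewrite addrAC subrr add0r; apply: vanishN; rewrite -mul2n; apply: vanishX.
by rewrite -opprB; apply: vanishN; apply: vanish_sinhc_half_sub1.
Qed.

Lemma vanish_cancel M (f p : {poly rat}) : f`_0 != 0 -> vanish M (f * p) -> vanish M p.
Proof.
move=> f0 /vanishP fp0; apply/vanishP => i; elim/ltn_ind: i => i IH lti.
have := fp0 i lti; rewrite coefM big_ord_recl /= subn0 big1 => [|j _].
  by move/eqP; rewrite addr0 mulf_eq0 (negbTE f0) => /eqP.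
by rewrite IH ?mulr0 //; rewrite /bump /=; have := ltn_ord j; lia.
Qed.

(* The Riccati equation of [coth(x/2)/2 - 1/x]. *)
Lemma dlog_riccati N : let g := dlog N in
  vanish N.*2 ('X * g^`() + 2%:R *: g + 'X * g ^+ 2 - 4%:R^-1 *: 'X).
Proof.
move=> g; set f := sinhc_half N.
(* After multiplication by $f$, the relation $fg = f'$ turns the nonlinear equation into the linear
   one of [sinhc_half_ode]. *)
apply: (@vanish_cancel _ f).
  by rewrite coef_sinhc_half ltn0 expr0 mul1r (_ : 1`!%N = 1%N) // invr1 oner_eq0.
have [r fg] := vanish_dlog N; rewrite -/f -/g in fg.
have {}fg : f * g = f^`() + 'X^(N.*2) * r by rewrite -fg addrC subrK.
have [r2 ode] := sinhc_half_ode N; rewrite -/f in ode.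
have dfg : f^`() * g + f * g^`() = f^`()^`() + ('X^(N.*2.-1) *+ N.*2) * r + 'X^(N.*2) * r^`().
  by rewrite -derivM fg derivD derivM derivXn addrA.
(* Differentiating the error term loses one power of ['X], which the factor ['X] in front of $g'$
   restores. *)
have XX : 'X * ('X^(N.*2.-1) *+ N.*2) = N.*2%:R * 'X^(N.*2) :> {poly rat}.
  rewrite mulrnAr -exprS; clear.
  by case: N => [|N]; rewrite ?mulr0n ?mul0r //= mulr_natl.
exists (r2 + N.*2%:R * r + 'X * r^`() + 2%:R * r + 'X * g * r).
move: ode; rewrite -!mul_polyC polyCMn.
set q := (4%:R^-1)%:P => ode.
have {ode}ode : 'X * f^`()^`() = 'X^(N.*2) * r2 - 2%:R * f^`() + q * ('X * f).
  by rewrite -ode; ring.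
transitivity ('X * (f^`() * g + f * g^`()) - 'X * g * f^`() + 2%:R * (f * g)
  + 'X * g * (f * g) - q * ('X * f)); first by ring.
rewrite dfg fg !mulrDr ode [in LHS](mulrA 'X _ r) XX.
by ring.
Qed.

End LogDerivative.

Section LogCoefficients.
Implicit Types (m n i j N : nat).

Lemma log_sinhc_even N i : odd i -> (log_sinhc N)`_i = 0.
Proof.
move=> oi; have evf : sinhc_half N \Po (-1 *: 'X) = sinhc_half N.
  apply/polyP => j; rewrite coef_comp_scaleX coef_sinhc_half.
  by case: ifP => [|/norP[ej _]]; rewrite ?mul0r // -signr_odd (negbTE ej) expr0 mulr1.
have : log_sinhc N \Po (-1 *: 'X) = log_sinhc N.
  rewrite /log_sinhc /log_trunc raddf_sum; apply: eq_bigr => n _.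
  by rewrite /= comp_polyZ rmorphXn /= comp_polyB comp_polyC evf.
move/(congr1 (fun p : {poly rat} => p`_i)); rewrite /= coef_comp_scaleX -signr_odd oi expr1 mulrN1.
by move/eqP; rewrite -subr_eq0 -opprD oppr_eq0 -mulr2n mulrn_eq0 => /eqP.
Qed.

Lemma dlog_even N i : ~~ odd i -> (dlog N)`_i = 0.
Proof. by move=> ei; rewrite /dlog coef_deriv log_sinhc_even ?mul0rn. Qed.

(** [b_coef m] truncates at [m], while [dlog] needs one order for all coefficients. The two
    truncations of $f$ differ only beyond degree $2m$, and the additional powers $(f-1)^n$, $n > m$,
    begin in degree $2n$. *)
Lemma log_sinhc_stable m N : (m <= N)%N -> (log_sinhc m)`_m.*2 = (log_sinhc N)`_m.*2.
Proof.
move=> le_mN; apply/eqP; rewrite -subr_eq0 -coefB; apply/eqP.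
set fm := sinhc_half m; set fN := sinhc_half N.
suff v : vanish m.*2.+1 (log_sinhc m - log_sinhc N).
  by move/vanishP: v; apply.
rewrite /log_sinhc /log_trunc -/fm -/fN.
rewrite (@big_cat_nat _ _ _ m.+1 1%N N.+1) //= opprD addrA -sumrB.
apply: vanishD.
  apply: vanish_sum => n _; rewrite -scalerBr -mul_polyC; apply: vanishMl.
  rewrite subrXX; apply: vanishM; rewrite opprB addrA subrK.
  apply/vanishP => i lti; rewrite coefB !coef_sinhc_half.
  have -> : (m.*2 < i)%N = false by lia.
  have -> : (N.*2 < i)%N = false by lia.
  by rewrite subrr.
apply: vanishN; rewrite big_nat; apply: vanish_sum => n /andP[lt_mn _].
rewrite -mul_polyC; apply: vanishMl; apply: (@vanish_le _ (2 * n)); first by lia.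
by apply: vanishX; apply: vanish_sinhc_half_sub1.
Qed.

(** $\log f = 2\sum_m b_{2m}x^{2m}$, and differentiating gives another factor $2m$. *)
Lemma coef_dlog m N : (0 < m <= N)%N -> (dlog N)`_m.*2.-1 = 4%:R * m%:R * b_coef m.
Proof.
case: m => // m /= le_mN; rewrite /dlog coef_deriv /b_coef -/(log_sinhc _).
have e : m.*2.+2%:R = 2%:R * m.+1%:R :> rat by rewrite -doubleS -mul2n natrM.
rewrite (log_sinhc_stable le_mN) -(mulr_natr _ m.*2.+2) e -doubleS.
by field.
Qed.

End LogCoefficients.

(** * The addition theorem of coth *)

Section CothAddition.
Variables (g : {poly rat}) (M : nat).
Hypothesis g_even : forall i, ~~ odd i -> g`_i = 0.
Hypothesis riccati : vanish M ('X * g^`() + 2%:R *: g + 'X * g ^+ 2 - 4%:R^-1 *: 'X).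
Implicit Types a b c : {poly rat}.

(** $g(aX)$, a series in an auxiliary variable with polynomial coefficients. The auxiliary variable
    records the total degree in [a], [b], [c], so homogeneous parts are coefficients. *)
Definition rescaled a : {poly {poly rat}} := map_poly polyC g \Po (a *: 'X).

Lemma coef_rescaled a i : (rescaled a)`_i = g`_i *: a ^+ i.
Proof. by rewrite coef_comp_scaleX coef_map /= mul_polyC. Qed.

Definition quarter : {poly {poly rat}} := (4%:R^-1)%:P%:P.

Lemma rescaled_riccati a : exists r,
  'X * (rescaled a)^`() = quarter * a%:P * 'X - 2%:R * rescaled a
     - a%:P * 'X * rescaled a ^+ 2 + 'X^M * r.
Proof.
have [r E] := riccati; set h := map_poly polyC g.
have {}E : 'X * h^`() = (4%:R^-1)%:P%:P * 'X - 2%:R * h - 'X * h ^+ 2 + 'X^M * map_poly polyC r.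
  have := congr1 (map_poly polyC) E; rewrite -!mul_polyC.
  rewrite !(rmorphB, rmorphD, rmorphM, rmorphXn) /= !map_polyC map_polyX.
  rewrite -deriv_map -/h /= => <-.
  by rewrite !polyC1; ring.
exists ((a ^+ M)%:P * (map_poly polyC r \Po (a *: 'X))).
have := congr1 (fun p => p \Po (a *: 'X)) E.
have two : (2%:R : {poly {poly rat}}) = (2%:R)%:P by rewrite polyCMn.
rewrite two expr2 /= !(comp_polyB, comp_polyD, comp_polyM) comp_Xn_poly comp_polyX !comp_polyC.
rewrite /rescaled -/h deriv_comp derivZ derivX exprZn -!mul_polyC mulr1 -/quarter => E'.
transitivity (a%:P * 'X * (h^`() \Po a%:P * 'X)); first by ring.
by rewrite E'; ring.
Qed.

(* [a b c X^2] times [1/4 + g_a g_b + g_b g_c + g_c g_a + (g_a + g_b)/(cX)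
   + (g_b + g_c)/(aX) + (g_c + g_a)/(bX)], where [g_a = g(aX)]. When [a + b + c = 0]
   the Riccati equation makes it a solution of a linear differential equation
   whose only power series solution is [0]. *)
Definition coth_sum a b c : {poly {poly rat}} :=
  let A := rescaled a in let B := rescaled b in let C := rescaled c in
  quarter * (a * b * c)%:P * 'X ^+ 2
  + (a * b * c)%:P * 'X ^+ 2 * (A * B + B * C + C * A)
  + 'X * ((a * b)%:P * (A + B) + (b * c)%:P * (B + C) + (c * a)%:P * (C + A)).

(** Put $u_a = g_a + 1/(aX)$. The bracket is $S = 1/4 + u_au_b + u_bu_c + u_cu_a$, the Riccati
    equation reads $u_a' = a(1/4 - u_a^2)$, and $a+b+c = 0$ gives $S' = -(au_a+bu_b+cu_c)S$. The
    poles add $3/X$ to [H], and the factor $abcX^2$ takes $2/X$ away; this leaves the 1 in $1 +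
    XH$. *)
Lemma coth_sum_ode a b c : a + b + c = 0 ->
  let H := a%:P * rescaled a + b%:P * rescaled b + c%:P * rescaled c in
  exists r, 'X * (coth_sum a b c)^`() = - (1 + 'X * H) * coth_sum a b c + 'X^M * r.
Proof.
move=> abc0; rewrite /coth_sum.
have [ra Ea] := rescaled_riccati a; have [rb Eb] := rescaled_riccati b.
have [rc Ec] := rescaled_riccati c.
have pabc0 : c%:P = - (a%:P + b%:P) :> {poly {poly rat}}.
  by rewrite -polyCD -polyCN; congr _%:P; rewrite -[RHS]addr0 -abc0; ring.
move: Ea Eb Ec; rewrite !polyCM pabc0.
set A := rescaled a; set B := rescaled b; set C := rescaled c.
set q := quarter; have dq : q^`() = 0 by rewrite derivC.
set al := a%:P; set be := b%:P; move=> Ea Eb Ec.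
have da : al^`() = 0 by rewrite derivC.
have db : be^`() = 0 by rewrite derivC.
exists (ra * (al * be * (-(al + be)) * 'X^2 * (B + C) - 'X * al * al)
  + rb * (al * be * (-(al + be)) * 'X^2 * (A + C) - 'X * be * be)
  + rc * (al * be * (-(al + be)) * 'X^2 * (A + B) - 'X * (al + be) * (al + be))).
rewrite !(derivE, deriv_exp, derivM) /= -/al -/be.
transitivity (q * (al * be * - (al + be)) * 'X^2 * 2%:R
  + al * be * - (al + be) * 'X^2 * 2%:R * (A * B + B * C + C * A)
  + al * be * - (al + be) * 'X^2
    * ((B + C) * ('X * A^`()) + (A + C) * ('X * B^`()) + (A + B) * ('X * C^`()))
  + 'X * (al * be * (A + B) + be * - (al + be) * (B + C) + - (al + be) * al * (C + A))
  + 'X * (al * be * ('X * A^`() + 'X * B^`()) + be * - (al + be) * ('X * B^`() + 'X * C^`())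
          + - (al + be) * al * ('X * C^`() + 'X * A^`()))); first by ring.
by rewrite Ea Eb Ec; ring.
Qed.

(** For $P$ the series, the equation says $(i+1)P_i = -(HP)_{i-1}$, which determines all
    coefficients to be 0. *)
Lemma coth_sum_eq0 a b c i : a + b + c = 0 -> (i < M)%N -> (coth_sum a b c)`_i = 0.
Proof.
move=> abc0; have [r] := coth_sum_ode abc0.
move: (coth_sum a b c) (_ + _ * rescaled c) => P H ode; elim/ltn_ind: i => i IH lti.
have /(congr1 (fun p : {poly {poly rat}} => p`_i)) := ode.
rewrite coefD coefXnM lti addr0 mulNr coefN mulrDl mul1r coefD -mulrA coefXM coefXM coef_deriv.
have -> : (if i == 0%N then 0 else (H * P)`_i.-1) = 0.
  case: i IH lti => //= i IH lti; rewrite coefM big1 // => j _.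
  by rewrite IH ?mulr0 //; have := ltn_ord j; lia.
have -> : (if i == 0%N then 0 else P`_i.-1.+1 *+ i.-1.+1) = P`_i *+ i.
  by case: i {IH lti}.
rewrite addr0 => /eqP; rewrite -addr_eq0 -mulrSr -scaler_nat scaler_eq0 pnatr_eq0 /=.
by move/eqP.
Qed.

(** The coefficient of $x^py^q$ in $(g(x)+g(y))/(x+y) - g(x)g(y)$: for even $d = p+q$ one has
    $(x^{d+1}+y^{d+1})/(x+y) = \sum (-1)^q x^py^q$, and for odd $d$ the coefficient $g_{d+1}$ is
    0. *)
Definition addition_coef p q : rat := (-1) ^+ q * g`_(p + q).+1 - g`_p * g`_q.

Definition addition_poly d a b : {poly rat} :=
  \sum_(p < d.+1) addition_coef p (d - p) *: (a ^+ p * b ^+ (d - p)).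

Lemma mul_addition_poly d a b :
  (a + b) * addition_poly d a b = g`_d.+1 *: (a ^+ d.+1 + b ^+ d.+1)
     - (a + b) * (rescaled a * rescaled b)`_d.
Proof.
rewrite /addition_poly.
under eq_bigr => p _ do rewrite /addition_coef scalerBl.
rewrite sumrB mulrBr; congr (_ - _); last first.
  congr (_ * _); rewrite coefM; apply: eq_bigr => p _.
  by rewrite !coef_rescaled -scalerAl -scalerAr scalerA.
have [od|ed] := boolP (odd d).
  rewrite g_even /= ?od // scale0r big1 ?mulr0 // => p _.
  by rewrite subnKC ?leq_ord // g_even /= ?od // mulr0 scale0r.
have -> : a ^+ d.+1 + b ^+ d.+1 = a ^+ d.+1 - (- b) ^+ d.+1.
  by rewrite exprNn -signr_odd /= ed expr1 mulN1r opprK.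
rewrite subrXX opprK scalerAr scaler_sumr; congr (_ * _).
rewrite [RHS](reindex_inj rev_ord_inj); apply: eq_bigr => p _.
rewrite subnKC ?leq_ord // [in RHS]exprNn /= subSS subKn ?leq_ord // -[(-1) ^+ _ : rat]signr_odd.
rewrite -[(-1) ^+ (d - p) : {poly rat}]signr_odd mulrC -scalerA; congr (_ *: _).
by case: odd; rewrite ?expr1 ?expr0 ?scaleN1r ?scale1r ?mulN1r ?mulrN ?mul1r.
Qed.

(* The addition theorem of [coth], in degree [d]. *)
Lemma addition_poly_cyclic d a b c : a + b + c = 0 -> a * b * c != 0 -> (d.+2 < M)%N ->
  addition_poly d a b + addition_poly d b c + addition_poly d c a
  = (if d == 0%N then 4%:R^-1 else 0)%:P.
Proof.
move=> abc0 nz ltd; have := coth_sum_eq0 abc0 ltd.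
set A := rescaled a; set B := rescaled b; set C := rescaled c.
have X1 : g`_d.+1 *: (a ^+ d.+1 + b ^+ d.+1) = (a + b) * (addition_poly d a b + (A * B)`_d).
  by rewrite mulrDr mul_addition_poly subrK.
have X2 : g`_d.+1 *: (b ^+ d.+1 + c ^+ d.+1) = (b + c) * (addition_poly d b c + (B * C)`_d).
  by rewrite mulrDr mul_addition_poly subrK.
have X3 : g`_d.+1 *: (c ^+ d.+1 + a ^+ d.+1) = (c + a) * (addition_poly d c a + (C * A)`_d).
  by rewrite mulrDr mul_addition_poly subrK.
have q0 : (quarter * (a * b * c)%:P * 'X^2)`_d.+2
    = (a * b * c) * (if d == 0%N then 4%:R^-1 else 0)%:P.
  rewrite /quarter coefMXn /= subSS subSS subn0 -polyCM coefC.
  by case: (d == 0%N); rewrite ?mulr0 // mulrC.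
have s0 : ((a * b * c)%:P * 'X^2 * (A * B + B * C + C * A))`_d.+2
    = (a * b * c) * ((A * B)`_d + (B * C)`_d + (C * A)`_d).
  by rewrite mulrAC coefMXn /= subSS subSS subn0 coefCM !coefD.
rewrite /coth_sum -/A -/B -/C 2!coefD q0 s0 coefXM /= !coefD !coefCM !coefD.
(* Since $a+b = -c$, the term $ab(g_a+g_b)$ yields $-abc$ times [addition_poly] plus the coefficient
   of $g_ag_b$; the latter cancels the product term of [coth_sum], and $abc$ can be divided out. *)
rewrite !coef_rescaled -!scalerDr X1 X2 X3.
move: (addition_poly d a b) (addition_poly d b c) (addition_poly d c a)
  ((A * B)`_d) ((B * C)`_d) ((C * A)`_d) (if _ then _ else _)%:P => x1 x2 x3 s1 s2 s3 q E.
apply: (mulfI nz); apply/eqP; rewrite -subr_eq0 -oppr_eq0; apply/eqP; rewrite -[RHS]E.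
by have -> : c = - (a + b); [rewrite -[RHS]addr0 -abc0|]; ring.
Qed.

End CothAddition.

(** * Theta graphs with legs as polynomials modulo x + y + z *)

Section SlidingFunctional.
Variables (W : lmodType rat) (t : nat -> nat -> nat -> W).
Hypothesis slide : forall p q r, t p.+1 q r + t p q.+1 r + t p q r.+1 = 0.
Hypothesis cyclic : forall p q r, t p q r = t q r p.

(* Sends the homogeneous polynomial [x^p y^q z^r], taken at [x = 1], [y = X],
   [z = - 1 - X], to [t p q r]. *)
Definition slide_eval d (P : {poly rat}) : W := \sum_(i < d.+1) P`_i *: t (d - i) i 0.

Lemma slide_evalD d P Q : slide_eval d (P + Q) = slide_eval d P + slide_eval d Q.
Proof. by rewrite -big_split; apply: eq_bigr => i _; rewrite coefD scalerDl. Qed.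

Lemma slide_evalZ d c P : slide_eval d (c *: P) = c *: slide_eval d P.
Proof. by rewrite scaler_sumr; apply: eq_bigr => i _; rewrite coefZ scalerA. Qed.

Lemma slide_eval_sum d I (r : seq I) (F : I -> {poly rat}) :
  slide_eval d (\sum_(i <- r) F i) = \sum_(i <- r) slide_eval d (F i).
Proof.
apply: (big_morph _ (@slide_evalD d)).
by rewrite /slide_eval big1 // => i _; rewrite coef0 scale0r.
Qed.

(** Induction on [r]: replacing one factor $z$ by $-x-y$ is exactly the relation [slide]. *)
Lemma slide_eval_monomial p q r :
  slide_eval (p + q + r) ('X^q * (- 1 - 'X) ^+ r) = t p q r.
Proof.
elim: r p q => [|r IH] p q.
  rewrite expr0 mulr1 addn0 /slide_eval.
  have ltq : (q < (p + q).+1)%N by rewrite ltnS leq_addl.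
  rewrite (bigD1 (Ordinal ltq)) //= coefXn eqxx scale1r addnK big1 ?addr0 // => i iq.
  by rewrite coefXn (_ : (_ == _) = false) ?scale0r //; apply: negbTE.
have -> : ('X^q * (- 1 - 'X) ^+ r.+1 : {poly rat}) =
    (-1) *: ('X^q * (- 1 - 'X) ^+ r) + (-1) *: ('X^(q.+1) * (- 1 - 'X) ^+ r).
  by rewrite !scaleN1r !exprS; ring.
have e1 : (p + q + r.+1 = p.+1 + q + r)%N by lia.
have e2 : (p + q + r.+1 = p + q.+1 + r)%N by lia.
rewrite slide_evalD !slide_evalZ {1}e1 e2 !IH !scaleN1r.
by rewrite -opprD; apply/eqP; rewrite eq_sym -addr_eq0 addrC slide.
Qed.

(** The addition theorem is evaluated at $(1, X, -1-X)$. By [cyclic] its three summands have the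
    same value, so each is a third of $1/4$ in degree 0, and 0 in higher degree. *)
Lemma addition_sum (g : {poly rat}) M d :
    (forall i, ~~ odd i -> g`_i = 0) ->
    vanish M ('X * g^`() + 2%:R *: g + 'X * g ^+ 2 - 4%:R^-1 *: 'X) -> (d.+2 < M)%N ->
  \sum_(p < d.+1) addition_coef g p (d - p) *: t p (d - p) 0
  = (if d == 0%N then 12%:R^-1 else 0) *: t 0 0 0.
Proof.
move=> g_even riccati ltd; set S := LHS.
have sum0 : 1 + 'X + (- 1 - 'X) = 0 :> {poly rat} by ring.
have nz : 1 * 'X * (- 1 - 'X) != 0 :> {poly rat}.
  rewrite mul1r mulf_neq0 ?polyX_eq0 // -opprD oppr_eq0 addrC -[1]opprK -polyC1 -polyCN.
  by rewrite polyXsubC_eq0.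
have := addition_poly_cyclic g_even riccati sum0 nz ltd.
move/(congr1 (slide_eval d)); rewrite !slide_evalD.
have ev1 : slide_eval d (addition_poly g d 1 'X) = S.
  rewrite slide_eval_sum; apply: eq_bigr => p _; rewrite slide_evalZ expr1n mul1r.
  congr (_ *: _); have := slide_eval_monomial p (d - p) 0.
  by rewrite expr0 mulr1 addn0 subnKC ?leq_ord.
have ev2 : slide_eval d (addition_poly g d 'X (- 1 - 'X)) = S.
  rewrite slide_eval_sum; apply: eq_bigr => p _; rewrite slide_evalZ.
  congr (_ *: _); have := slide_eval_monomial 0 p (d - p).
  by rewrite add0n subnKC ?leq_ord // cyclic.
have ev3 : slide_eval d (addition_poly g d (- 1 - 'X) 1) = S.
  rewrite slide_eval_sum; apply: eq_bigr => p _; rewrite slide_evalZ expr1n mulr1.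
  congr (_ *: _); have := slide_eval_monomial (d - p) 0 p.
  by rewrite expr0 mul1r addn0 subnK ?leq_ord // cyclic cyclic.
have evC c : slide_eval d c%:P = c *: t d 0 0.
  have := slide_eval_monomial d 0 0; rewrite !expr0 mulr1 !addn0 => <-.
  by rewrite -slide_evalZ alg_polyC.
rewrite ev1 ev2 ev3 evC => E; apply: (scalerI (_ : 3%:R != 0 :> rat)) => //.
rewrite scalerA -[3%:R]/(1 + 1 + 1 : rat) !scalerDl !scale1r E.
by case: d {ltd S ev1 ev2 ev3 evC E} => [|d] /=; rewrite ?mulr0 ?scale0r.
Qed.

End SlidingFunctional.

(** * Polynomials in wheels *)

Section MonomialFunctional.
Variables (n : nat) (W : lmodType rat).
Implicit Types (f : 'X_{1..n} -> W) (p q : {mpoly rat[n]}) (m : 'X_{1..n}).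

Definition mpoly_eval f p : W := \sum_(m <- msupp p) p@_m *: f m.

Lemma mpoly_eval_bounded f p d : (msize p <= d)%N ->
  mpoly_eval f p = \sum_(m : 'X_{1..n < d}) p@_m *: f m.
Proof.
move=> le_pd; rewrite /mpoly_eval; pose I : subFinType _ := 'X_{1..n < d}.
rewrite (big_mksub I) /=; first last.
- by move=> x /msize_mdeg_lt /leq_trans; apply.
- by rewrite msupp_uniq.
by rewrite big_rmcond //= => m /memN_msupp_eq0 ->; rewrite scale0r.
Qed.

Lemma mpoly_eval_linear f c p q :
  mpoly_eval f (c *: p + q) = c *: mpoly_eval f p + mpoly_eval f q.
Proof.
pose d := maxn (msize (c *: p + q)) (maxn (msize p) (msize q)).
rewrite !(@mpoly_eval_bounded f _ d) ?leq_max ?leqnn ?orbT //.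
rewrite scaler_sumr -big_split; apply: eq_bigr => m _ /=.
by rewrite mcoeffD mcoeffZ scalerDl scalerA.
Qed.

Lemma mpoly_eval0 f : mpoly_eval f 0 = 0.
Proof. by rewrite /mpoly_eval msupp0 big_nil. Qed.

Lemma mpoly_evalZ f c p : mpoly_eval f (c *: p) = c *: mpoly_eval f p.
Proof. by rewrite -[c *: p]addr0 mpoly_eval_linear mpoly_eval0 addr0. Qed.

Lemma mpoly_evalD f p q : mpoly_eval f (p + q) = mpoly_eval f p + mpoly_eval f q.
Proof. by rewrite -{1}[p]scale1r mpoly_eval_linear scale1r. Qed.

Lemma mpoly_eval_sum f I (r : seq I) (P : pred I) (F : I -> {mpoly rat[n]}) :
  mpoly_eval f (\sum_(i <- r | P i) F i) = \sum_(i <- r | P i) mpoly_eval f (F i).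
Proof. exact: (big_morph _ (@mpoly_evalD f) (@mpoly_eval0 f)). Qed.

Lemma mpoly_evalX f m : mpoly_eval f 'X_[m] = f m.
Proof. by rewrite /mpoly_eval msuppX big_seq1 mcoeffX eqxx scale1r. Qed.

Lemma mpoly_eval_homog (f : 'X_{1..n} -> W) d p : p \is d.-homog ->
  (forall m, mdeg m = d -> f m = 0) -> mpoly_eval f p = 0.
Proof.
move=> /dhomogP hp f0; rewrite /mpoly_eval big_seq big1 // => m /hp /= md.
by rewrite f0 ?scaler0.
Qed.

Lemma mpoly_eval_pihomog f (mf : measure n) d p : (forall m, mf m != d -> f m = 0) ->
  mpoly_eval f (pihomog mf d p) = mpoly_eval f p.
Proof.
move=> f0; rewrite pihomogE mpoly_eval_sum [RHS]/mpoly_eval.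
rewrite [RHS](bigID (fun m => mf m == d)) /= [X in _ + X]big1 ?addr0.
  by apply: eq_bigr => m _; rewrite mpoly_evalZ mpoly_evalX.
by move=> m /f0->; rewrite scaler0.
Qed.

Variable b : nat -> rat.

Definition lin_form : {mpoly rat[n]} := \sum_(i < n) b i.+1 *: 'X_i.

Definition exp_trunc N : {mpoly rat[n]} := \sum_(d < N.+1) (d`!%:R)^-1 *: lin_form ^+ d.

Lemma mderiv_lin_form i : lin_form^`M(i) = (b i.+1)%:MP.
Proof.
rewrite /lin_form raddf_sum (bigD1 i) //= big1 => [|j ij].
  have UU : (U_(i) - U_(i))%MM = 0%MM by apply/mnmP => j; rewrite mnmBE subnn mnm0E.
  by rewrite addr0 mderivZ mderivX mnm1E eqxx scale1r UU mpolyX0 -mul_mpolyC mulr1.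
by rewrite mderivZ mderivX mnm1E (negbTE ij) scale0r scaler0.
Qed.

Lemma mderiv_expr i p d : (p ^+ d)^`M(i) = d%:R *: (p ^+ d.-1 * p^`M(i)).
Proof.
elim: d => [|d IH]; first by rewrite expr0 -mpolyC1 mderivC scale0r.
rewrite exprS mderivM IH /= -scalerAr.
case: d {IH} => [|d]; first by rewrite expr0 scale0r addr0 scale1r mulr1 mul1r.
by rewrite mulrA -exprS mulrC -[X in X + _]scale1r -scalerDl nat1r.
Qed.

(** $\partial_i e^L = b\,e^L$, at the price of one order of truncation. *)
Lemma mderiv_exp_trunc i N : (exp_trunc N.+1)^`M(i) = b i.+1 *: exp_trunc N.
Proof.
rewrite /exp_trunc big_ord_recl raddfD /= raddf_sum.
rewrite expr0 mderivZ -mpolyC1 mderivC scaler0 add0r scaler_sumr.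
apply: eq_bigr => d _; rewrite /= mderivZ mderiv_expr mderiv_lin_form mulrC.
rewrite mul_mpolyC !scalerA /bump /= add1n factS natrM; congr (_ *: _).
have n1 : d.+1%:R != 0 :> rat by rewrite pnatr_eq0.
have nf : d`!%:R != 0 :> rat by rewrite pnatr_eq0 -lt0n fact_gt0.
move: n1; rewrite -natr1 => n1.
by field; rewrite nf n1.
Qed.

Lemma lin_form_homog d : lin_form ^+ d \is d.-homog.
Proof.
have h1 : lin_form \is 1.-homog.
  by apply: rpred_sum => i _; apply: rpredZ; rewrite dhomogX /= mdeg1.
elim: d => [|d IH]; first by rewrite expr0 dhomog1.
by rewrite exprS -add1n; apply: dhomogM.
Qed.

Lemma mpoly_eval_exp_trunc f N N' : (N <= N')%N ->
    (forall m, (N < mdeg m)%N -> f m = 0) ->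
  mpoly_eval f (exp_trunc N') = mpoly_eval f (exp_trunc N).
Proof.
move=> le_NN f0; rewrite -(subnKC le_NN) /exp_trunc -addSn big_split_ord /=.
rewrite mpoly_evalD [X in _ + X]mpoly_eval_sum [X in _ + X]big1 ?addr0 // => d _.
rewrite mpoly_evalZ (mpoly_eval_homog (lin_form_homog _)) ?scaler0 // => m md.
by apply: f0; rewrite md; lia.
Qed.

End MonomialFunctional.

Lemma sum_antidiagonals (W : nmodType) (F : nat -> nat -> W) n :
  \sum_(d < n) \sum_(p < d.+1) F p (d - p)%N = \sum_(p < n) \sum_(q < n - p) F p q.
Proof.
elim: n => [|n IH]; first by rewrite !big_ord0.
rewrite big_ord_recr /= IH [RHS]big_ord_recr /= subSn // subnn big_ord1.
rewrite [X in _ + X]big_ord_recr /= subnn addrA -big_split /=.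
congr (_ + _); apply: eq_bigr => p _.
by rewrite subSn ?big_ord_recr // ltnW.
Qed.

Lemma sum_doubled (W : nmodType) (F : nat -> W) n :
  \sum_(p < n.*2) F p = \sum_(i < n) (F i.*2 + F i.*2.+1).
Proof.
by elim: n => [|n IH]; rewrite ?big_ord0 // doubleS !big_ord_recr /= IH addrA.
Qed.

(** * Evaluation of polynomials on wheels *)

Section WheelPolynomials.
Variable k : nat.
Local Notation A := (graph_homology k).
Implicit Types (m : 'X_{1..k}) (p : {mpoly rat[k]}).

(* The variable of index [i] stands for the wheel with [2(i+1)] spokes. *)
Definition wheel_sizes m : seq nat := flatten [seq nseq (m i) (val i).+1.*2 | i <- enum 'I_k].

Lemma count_wheel_sizes P m : count P (wheel_sizes m) = (\sum_(i < k) m i * P i.+1.*2)%N.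
Proof.
rewrite /wheel_sizes count_flatten -map_comp sumnE big_map big_enum /=.
by apply: eq_bigr => i _; rewrite /= count_nseq mulnC.
Qed.

Lemma sumn_wheel_sizes m : sumn (wheel_sizes m) = (mnmwgt m).*2.
Proof.
rewrite /wheel_sizes sumn_flatten -map_comp sumnE big_map big_enum /= /mnmwgt.
rewrite -muln2 big_distrl /=; apply: eq_bigr => i _.
by rewrite sumn_nseq mulnC -muln2 mulnA.
Qed.

Lemma wheel_sizes_even m : all (fun s => ~~ odd s) (wheel_sizes m).
Proof.
apply/allP => s /flattenP[t /mapP[i _ ->]] /nseqP[-> _].
by rewrite odd_double.
Qed.

Lemma wheel_sizesD i m : perm_eq (wheel_sizes (U_(i) + m)) (i.+1.*2 :: wheel_sizes m).
Proof.
apply/seq.permP => P; rewrite /= !count_wheel_sizes.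
rewrite (eq_bigr (fun j : 'I_k => U_(i)%MM j * P j.+1.*2 + m j * P j.+1.*2)%N).
  rewrite big_split /=; congr (_ + _)%N.
  rewrite (bigD1 i) //= mnm1E eqxx mul1n big1 ?addn0 // => j ij.
  by rewrite mnm1E eq_sym (negbTE ij).
by move=> j _; rewrite mnmDE mulnDl.
Qed.

Definition wheel_mon j m : A := wheel_val k j (wheel_sizes m).
Definition theta_mon j a b c m : A := theta_val k j (wheel_sizes m) a b c.

Lemma wheel_mon_weight j m : (j + mnmwgt m != k)%N -> wheel_mon j m = 0.
Proof.
move=> tot; rewrite /wheel_mon /wheel_val ifN // sumn_wheel_sizes -doubleD.
by rewrite (inj_eq double_inj).
Qed.

Lemma theta_mon_weight j a b c m : (j.*2.+2 + (a + b + c) + (mnmwgt m).*2 != k.*2)%N ->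
  theta_mon j a b c m = 0.
Proof. by move=> tot; rewrite /theta_mon /theta_val sumn_wheel_sizes ifN. Qed.

(** Euler's identity: [wheel_mon j] is 0 except in weight $k-j$, where $\sum_i (i+1)x_i\partial_i$
    acts as multiplication by the weight. It exhibits a wheel ['X_i] to expand. *)
Lemma wheel_mon_euler j p : (j <= k)%N ->
  (k - j)%:R *: mpoly_eval (wheel_mon j) p =
  \sum_(i < k) i.+1%:R *: mpoly_eval (wheel_mon j) ('X_i * p^`M(i)).
Proof.
move=> le_jk; elim/mpolyind: p => [|c m p _ _ IH].
  rewrite mpoly_eval0 scaler0 big1 // => i _.
  by rewrite mderiv0 mulr0 mpoly_eval0 scaler0.
rewrite mpoly_eval_linear scalerDr IH.
under [RHS]eq_bigr => i _ do
  rewrite mderivD mderivZ mulrDr -scalerAr mpoly_eval_linear scalerDr.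
rewrite big_split /=; congr (_ + _); rewrite mpoly_evalX.
under eq_bigr => i _ do rewrite mderivX -scalerAr mpoly_evalZ scalerA scalerA.
have E (i : 'I_k) : (i.+1%:R * (c * (m i)%:R)) *: mpoly_eval (wheel_mon j) ('X_i * 'X_[m - U_(i)])
    = (c * (m i * i.+1)%:R) *: wheel_mon j m.
  have [mi0|mi] := posnP (m i); first by rewrite mi0 mul0n !mulr0 !scale0r.
  rewrite -mpolyXD mpoly_evalX addmC submK; last by rewrite lep1mP -lt0n.
  by rewrite natrM; congr (_ *: _); ring.
under eq_bigr => i _ do rewrite E.
rewrite -scaler_suml -mulr_sumr -natr_sum -/(mnmwgt m) scalerA mulrC.
have [tot|tot] := eqVneq (j + mnmwgt m)%N k; last by rewrite wheel_mon_weight ?scaler0.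
by have -> : (k - j = mnmwgt m)%N by lia.
Qed.

(** Passing from positions to values makes equal wheels countable by their multiplicity. *)
Lemma sum_rem_nth (W : nmodType) (G : nat -> seq nat -> W) (s : seq nat) :
    (forall x t t', perm_eq t t' -> G x t = G x t') ->
  \sum_(l < size s) G (nth 0%N s l) (take l s ++ drop l.+1 s) = \sum_(x <- s) G x (rem x s).
Proof.
move=> Gperm; rewrite (big_nth 0%N) big_mkord; apply: eq_bigr => l _.
apply: Gperm; rewrite -(perm_cons (nth 0%N s l)).
apply: (perm_trans _ (perm_to_rem (mem_nth _ (ltn_ord l)))).
by rewrite -cat1s perm_catCA /= -drop_nth // cat_take_drop.
Qed.

(** The coefficient is $2$ for the join, times the $2(i'+1)$ spokes of the other wheel, times its
    multiplicity. *)
Lemma wheel_mon_expand j i m :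
  wheel_mon j (U_(i) + m) =
  \sum_(s < i.*2.+1) (-1) ^+ (i.*2 - s) *: theta_mon j s (i.*2 - s) 0 m
  - \sum_(i' < k) (4 * i'.+1 * m i')%:R *: theta_mon j i.*2.+1 i'.*2.+1 0 (m - U_(i')).
Proof.
rewrite /wheel_mon (wheel_val_perm _ _ (wheel_sizesD i m)) doubleS.
rewrite wheel_val_expand /= ?odd_double ?wheel_sizes_even //; congr (_ - _).
pose G x sh := (2 * x)%:R *: theta_val k j sh i.*2.+1 x.-1 0.
rewrite (@sum_rem_nth _ G) /G; last by move=> x t t' tt; rewrite (theta_val_perm _ _ _ _ _ tt).
rewrite big_flatten big_map big_enum /=; apply: eq_bigr => i' _.
rewrite big_nseq iter_addr addr0 -scaler_nat scalerA /= -natrM.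
have [mi0|mi] := posnP (m i'); first by rewrite mi0 mul0n muln0 !scale0r.
rewrite /theta_mon (@theta_val_perm _ _ _ (wheel_sizes (m - U_(i')))).
  by congr (_%:R *: _); lia.
have x_in : i'.+1.*2 \in wheel_sizes m.
  by rewrite -has_pred1 has_count count_wheel_sizes (bigD1 i') //= eqxx muln1 addn_gt0 mi.
rewrite -(perm_cons i'.+1.*2) -(permPl (perm_to_rem x_in)).
have {1}-> : m = (U_(i') + (m - U_(i')))%MM by rewrite addmC submK // lep1mP -lt0n.
exact: wheel_sizesD.
Qed.

(** The multiplicity of the second wheel becomes a derivative, so for an exponential the expansion
    closes up. *)
Lemma mpoly_eval_wheel_expand j i p :
  mpoly_eval (wheel_mon j) ('X_i * p) =
  \sum_(s < i.*2.+1) (-1) ^+ (i.*2 - s) *: mpoly_eval (theta_mon j s (i.*2 - s) 0) p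
  - \sum_(i' < k) (4 * i'.+1)%:R *:
      mpoly_eval (theta_mon j i.*2.+1 i'.*2.+1 0) p^`M(i').
Proof.
elim/mpolyind: p => [|c m p _ _ IH].
  rewrite mulr0 !mpoly_eval0 !big1 ?subr0 // => s _.
    by rewrite mderiv0 mpoly_eval0 scaler0.
  by rewrite mpoly_eval0 scaler0.
rewrite mulrDr -scalerAr mpoly_eval_linear IH -mpolyXD mpoly_evalX wheel_mon_expand.
under [in RHS]eq_bigr => s _ do
  rewrite mpoly_eval_linear mpoly_evalX scalerDr scalerA mulrC -scalerA.
under [X in _ = _ - X]eq_bigr => s _ do
  rewrite mderivD mderivZ mderivX mpoly_eval_linear mpoly_evalZ mpoly_evalX scalerDr.
rewrite !big_split /= -scaler_sumr opprD addrACA; congr (_ + _).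
rewrite scalerBr; congr (_ - _); rewrite scaler_sumr; apply: eq_bigr => i' _.
by rewrite !scalerA; congr (_ *: _); rewrite (natrM _ _ (m i')); ring.
Qed.

End WheelPolynomials.

(** * The recursion in the number of copies of Theta *)

Section ExponentialRecursion.
Variable k : nat.
Local Notation A := (graph_homology k).
Implicit Types (m : 'X_{1..k}) (p : {mpoly rat[k]}).

Local Notation E := (exp_trunc k b_coef).
Definition wheel_exp j : A := mpoly_eval (wheel_mon j) (E k).
Definition theta_exp j a b c : A := mpoly_eval (theta_mon j a b c) (E k).

Lemma wheel_mon_mdeg j m : (k < mdeg m)%N -> wheel_mon j m = 0.
Proof. by move=> lt_km; apply: wheel_mon_weight; have := leq_mdeg_mnmwgt m; lia. Qed.

Lemma theta_mon_mdeg j a b c m : (k < mdeg m)%N -> theta_mon j a b c m = 0.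
Proof. by move=> lt_km; apply: theta_mon_weight; have := leq_mdeg_mnmwgt m; lia. Qed.

Lemma wheel_expE j N : (k <= N)%N -> mpoly_eval (wheel_mon j) (E N) = wheel_exp j.
Proof. by move=> le_kN; apply: mpoly_eval_exp_trunc => // m; apply: wheel_mon_mdeg. Qed.

Lemma theta_expE j a b c N : (k <= N)%N ->
  mpoly_eval (theta_mon j a b c) (E N) = theta_exp j a b c.
Proof. by move=> le_kN; apply: mpoly_eval_exp_trunc => // m; apply: theta_mon_mdeg. Qed.

Lemma theta_exp_slide j a b c :
  theta_exp j a.+1 b c + theta_exp j a b.+1 c + theta_exp j a b c.+1 = 0.
Proof.
rewrite /theta_exp /mpoly_eval -!big_split big1 //= => m _.
by rewrite -!scalerDr /theta_mon theta_val_slide scaler0.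
Qed.

Lemma theta_exp_cyclic j a b c : theta_exp j a b c = theta_exp j b c a.
Proof. by apply: eq_bigr => m _; rewrite /theta_mon theta_val_cyclic. Qed.

Lemma theta_exp000 j : theta_exp j 0 0 0 = wheel_exp j.+1.
Proof. by apply: eq_bigr => m _; rewrite /theta_mon theta_val000. Qed.

Lemma theta_exp_large j a b c : (k.*2 <= a + b + c)%N -> theta_exp j a b c = 0.
Proof.
move=> le_k; rewrite /theta_exp /mpoly_eval big1 // => m _.
by rewrite theta_mon_weight ?scaler0 //; lia.
Qed.

Lemma wheel_exp_euler j : (j < k)%N ->
  (k - j)%:R *: wheel_exp j = \sum_(i < k) (i.+1%:R * b_coef i.+1) *:
    (\sum_(s < i.*2.+1) (-1) ^+ (i.*2 - s) *: theta_exp j s (i.*2 - s) 0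
     - \sum_(i' < k) (4 * i'.+1%:R * b_coef i'.+1) *: theta_exp j i.*2.+1 i'.*2.+1 0).
Proof.
move=> lt_jk.
(* Two derivatives will be taken, each lowering the order of truncation by one. *)
rewrite -(@wheel_expE j k.+2) ?leqW //.
rewrite wheel_mon_euler ?(ltnW lt_jk) //; apply: eq_bigr => i _.
rewrite mderiv_exp_trunc -scalerAr mpoly_evalZ scalerA mpoly_eval_wheel_expand.
have F (c : rat) (X Y X' Y' : A) : X = X' -> Y = Y' -> c *: (X - Y) = c *: (X' - Y').
  by move=> -> ->.
apply: F; apply: eq_bigr => s _.
  apply: congr1; apply: theta_expE; exact: leqnSn.
rewrite mderiv_exp_trunc mpoly_evalZ (theta_expE _ _ _ _ (leqnn k)) scalerA natrM.
reflexivity.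
Qed.

Lemma wheel_exp_rec j : (j < k)%N -> (48%:R * (k - j)%:R) *: wheel_exp j = wheel_exp j.+1.
Proof.
(* This order makes the Riccati equation hold modulo $x^{2k+4}$, beyond $d+2$ for every $d < 2k$. *)
move=> lt_jk; set g := dlog k.+2; pose t := theta_exp j.
have g_odd i : (i < k)%N -> i.+1%:R * b_coef i.+1 = 4%:R^-1 * g`_i.*2.+1.
  move=> lt_ik; have := @coef_dlog i.+1 k.+2; rewrite doubleS /= -/g => -> //; last by lia.
  by move: (b_coef _) => B; field.
have g_odd4 i : (i < k)%N -> 4%:R * i.+1%:R * b_coef i.+1 = g`_i.*2.+1.
  by move=> lt_ik; rewrite -mulrA g_odd // mulrA mulfV // mul1r.
have g_even := @dlog_even k.+2; rewrite -/g in g_even.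
have D d : (d < k.*2)%N -> \sum_(a < d.+1) addition_coef g a (d - a) *: t a (d - a)%N 0%N
    = (if d == 0%N then 12%:R^-1 else 0) *: t 0%N 0%N 0%N.
  move=> lt_d; apply: (addition_sum (@theta_exp_slide j) (@theta_exp_cyclic j) g_even
    (@dlog_riccati k.+2)); by lia.
(* Odd $d$ may be added because $g$ has no coefficients of even index. *)
have first_part : \sum_(i < k) \sum_(s < i.*2.+1)
      ((-1) ^+ (i.*2 - s) * g`_i.*2.+1) *: t s (i.*2 - s)%N 0%N
    = \sum_(d < k.*2) \sum_(s < d.+1) ((-1) ^+ (d - s) * g`_d.+1) *: t s (d - s)%N 0%N.
  rewrite (sum_doubled (fun d => \sum_(s < d.+1) ((-1) ^+ (d - s) * g`_d.+1) *: t s (d - s)%N 0%N)).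
  apply: eq_bigr => i _; rewrite [X in _ + X]big1 ?addr0 // => s _.
  by rewrite g_even ?mulr0 ?scale0r //= odd_double.
(* The left side ranges over a square and the right side over the triangle $a+b < 2k$; outside the
   triangle there are too many legs and [theta_exp_large] gives 0. *)
have second_part : \sum_(i < k) \sum_(i' < k) (g`_i.*2.+1 * g`_i'.*2.+1) *: t i.*2.+1 i'.*2.+1 0%N
    = \sum_(d < k.*2) \sum_(a < d.+1) (g`_a * g`_(d - a)) *: t a (d - a)%N 0%N.
  rewrite (@sum_antidiagonals _ (fun a b => (g`_a * g`_b) *: t a b 0%N)).
  rewrite (sum_doubled (fun a => \sum_(b < k.*2 - a) (g`_a * g`_b) *: t a b 0%N)).
  apply: eq_bigr => i _; rewrite [X in X + _]big1 ?add0r => [|b _]; last first.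
    by rewrite g_even ?mul0r ?scale0r // odd_double.
  transitivity (\sum_(b < k.*2) (g`_i.*2.+1 * g`_b) *: t i.*2.+1 b 0%N).
    rewrite (sum_doubled (fun b => (g`_i.*2.+1 * g`_b) *: t i.*2.+1 b 0%N)).
    by apply: eq_bigr => i' _; rewrite (g_even i'.*2) ?odd_double // mulr0 scale0r add0r.
  have le : (k.*2 - i.*2.+1 <= k.*2)%N by lia.
  rewrite (big_ord_widen _ (fun b => (g`_i.*2.+1 * g`_b) *: t i.*2.+1 b 0%N) le).
  rewrite [RHS]big_mkcond /=; apply: eq_bigr => b _; case: ltnP => // le_b.
  by rewrite /t theta_exp_large ?scaler0 //; lia.
(* The factor $1/4$ is that of [g_odd], and $1/12$ is the contribution of $d = 0$, the only degree
   that survives. *)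
have key : (k - j)%:R *: wheel_exp j = 4%:R^-1 *: (12%:R^-1 *: t 0%N 0%N 0%N).
  rewrite wheel_exp_euler //.
  transitivity (4%:R^-1 *: \sum_(d < k.*2)
      \sum_(a < d.+1) addition_coef g a (d - a) *: t a (d - a)%N 0%N); last first.
    congr (_ *: _); have k0 : (0 < k.*2)%N by lia.
    rewrite (bigD1 (Ordinal k0)) //= D // big1 ?addr0 // => d d0.
    by rewrite D // (_ : _ == _ = false) ?scale0r //; apply: negbTE.
  have -> : \sum_(d < k.*2) \sum_(a < d.+1) addition_coef g a (d - a) *: t a (d - a)%N 0%N
      = \sum_(d < k.*2) \sum_(s < d.+1) ((-1) ^+ (d - s) * g`_d.+1) *: t s (d - s)%N 0%N
        - \sum_(d < k.*2) \sum_(a < d.+1) (g`_a * g`_(d - a)) *: t a (d - a)%N 0%N.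
    rewrite -sumrB; apply: eq_bigr => d _; rewrite -sumrB; apply: eq_bigr => a _.
    by rewrite /addition_coef scalerBl subnKC // leq_ord.
  rewrite -first_part -second_part -sumrB scaler_sumr; apply: eq_bigr => i _.
  rewrite g_odd // -scalerA; congr (_ *: _); rewrite scalerBr; congr (_ - _).
    rewrite scaler_sumr; apply: eq_bigr => s _.
    by rewrite scalerA mulrC.
  rewrite scaler_sumr; apply: eq_bigr => i' _.
  by rewrite g_odd4 // scalerA.
rewrite -scalerA key -theta_exp000 !scalerA.
by rewrite (_ : _ * _ = 1) ?scale1r.
Qed.

Lemma wheel_exp_iter n j : (j + n)%N = k ->
  (48%:R ^+ n * n`!%:R) *: wheel_exp j = wheel_exp k.
Proof.
elim: n j => [|n IH] j jn; first by have -> : j = k by [lia]; rewrite expr0 mul1r scale1r.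
have lt_jk : (j < k)%N by lia.
rewrite -(IH j.+1); last by lia.
rewrite -wheel_exp_rec // scalerA; congr (_ *: _).
have -> : (k - j = n.+1)%N by lia.
by rewrite exprS factS natrM; ring.
Qed.

(** [k] copies of [Theta] use up all vertices, so only the constant term 1 of the exponential
    counts. *)
Lemma wheel_exp_top : wheel_exp k = gclass (theta_graph k).
Proof.
rewrite theta_graph_val /wheel_exp (@mpoly_eval_exp_trunc _ _ _ _ 0) //; last first.
  move=> m m0; apply: wheel_mon_weight; have := leq_mdeg_mnmwgt m; lia.
rewrite /exp_trunc big_ord1 expr0 invr1 scale1r -mpolyX0 mpoly_evalX /wheel_mon.
congr wheel_val; apply/nilP; rewrite /nilp -(count_predT (wheel_sizes _)) count_wheel_sizes.
by rewrite big1 // => i _; rewrite mnm0E.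
Qed.

End ExponentialRecursion.

(** * From the exponential to the Todd series and the polywheels *)

Section ToddClass.
Variable k : nat.

Lemma svar_double (i : 'I_k) : svar k i.+1.*2 = 'X_i.
Proof.
rewrite /svar doubleK /=; case: insubP => [j _ ji|]; last by rewrite ltn_ord.
by congr 'X_(_); apply: val_inj.
Qed.

Lemma Td_inv_sqrtE : Td_inv_sqrt k = pihomog (@mnmwgt k) k (exp_trunc k b_coef k).
Proof.
rewrite /Td_inv_sqrt /exp_trunc; congr pihomog; apply: eq_bigr => n _.
congr (_ *: _ ^+ _); rewrite big_add1 big_mkord /lin_form.
by apply: eq_bigr => i _; rewrite svar_double.
Qed.

(** Restricting to weight [k] loses nothing: with no copy of [Theta], monomials of any other weight
    have value 0. *)
Lemma Td_inv_sqrt_eval :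
  gclass (theta_graph k) =
    (48%:R ^+ k * k`!%:R) *: mpoly_eval (@wheel_mon k 0) (Td_inv_sqrt k).
Proof.
rewrite Td_inv_sqrtE mpoly_eval_pihomog; last first.
  by move=> m wm; apply: wheel_mon_weight; rewrite add0n.
by rewrite -/(wheel_exp k 0) wheel_exp_iter // wheel_exp_top.
Qed.

Lemma ex_s_monomial (s : seq nat) : all (fun p => ~~ odd p) s -> 0%N \notin s ->
    (sumn s <= k.*2)%N ->
  exists2 m, perm_eq (wheel_sizes m) s & \prod_(p <- s) svar k p = 'X_[m].
Proof.
elim: s => [|p s IH].
  move=> _ _ _; exists 0%MM; last by rewrite big_nil mpolyX0.
  have /nilP -> // : nilp (wheel_sizes (0%MM : 'X_{1..k})).
  rewrite /nilp -(count_predT (wheel_sizes _)) count_wheel_sizes.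
  by rewrite big1 // => i _; rewrite mnm0E.
rewrite /= inE negb_or => /andP[ep es] /andP[p0 s0] le_k.
have [|m pm sm] := IH es s0; first by apply: leq_trans le_k; rewrite leq_addl.
(* The part is at most $2k$, so [svar] is a genuine variable and not its default 0. *)
have hp := even_halfK ep; have lti : (p./2.-1 < k)%N by lia.
pose i := Ordinal lti; have pE : p = i.+1.*2 by rewrite -hp /=; lia.
exists (U_(i) + m)%MM; last by rewrite big_cons sm pE svar_double -mpolyXD.
by apply: (perm_trans (wheel_sizesD i m)); rewrite -pE perm_cons.
Qed.

Lemma parts_spec n (lam : intpart n) : 0%N \notin parts lam /\ sumn (parts lam) = n.
Proof. by rewrite /parts; case: lam => p /= /and3P[_ -> /eqP]. Qed.

Lemma s_monomial_eval (lam : intpart k.*2) : is_even lam ->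
  mpoly_eval (@wheel_mon k 0) (s_monomial lam) = polywheel lam.
Proof.
move=> elam; have [lam0 sum_lam] := parts_spec lam.
have [|m pm sm] := ex_s_monomial elam lam0; first by rewrite sum_lam.
by rewrite /s_monomial sm mpoly_evalX polywheel_val; apply: wheel_val_perm.
Qed.

Lemma ex_intpart n (s : seq nat) : 0%N \notin s -> sumn s = n ->
  exists lam : intpart n, perm_eq (parts lam) s.
Proof.
move=> s0 sum_s; pose t := sort geq s.
have pts : perm_eq t s by rewrite perm_sort.
have t0 : 0%N \notin t by rewrite (perm_mem pts).
have sum_t : sumn t = n by rewrite (perm_sumn pts).
have size_le (r : seq nat) : 0%N \notin r -> (size r <= sumn r)%N.
  elim: r => //= x r IH; rewrite inE negb_or => /andP[x0 /IH]; lia.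
have mem_le (r : seq nat) x : x \in r -> (x <= sumn r)%N.
  by elim: r => //= y r IH; rewrite inE => /orP[/eqP->|/IH]; lia.
pose u : seq 'I_n.+1 := map inord t.
have ut : map val u = t.
  rewrite -map_comp -[RHS]map_id; apply/eq_in_map => x xt /=.
  by rewrite inordK // ltnS -sum_t mem_le.
have size_u : (size u <= n)%N by rewrite size_map -sum_t size_le.
have vu : is_intpart (Bseq size_u).
  rewrite /is_intpart /= ut t0 sum_t eqxx !andbT.
  by apply: sort_sorted => x y; rewrite /geq /= leq_total.
by exists (IntPart vu); rewrite /parts /= ut.
Qed.

Lemma wheel_mon_in_span (m : 'X_{1..k}) : in_polywheel_subspace (wheel_mon 0 m).
Proof.
have [wm|wm] := eqVneq (mnmwgt m) k; last first.
  exists (fun _ => 0); rewrite wheel_mon_weight ?add0n //.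
  by rewrite big1 // => lam _; rewrite scale0r.
have [||lam plam] := @ex_intpart k.*2 (wheel_sizes m).
- rewrite -has_pred1 has_count count_wheel_sizes big1 // => i _.
  by rewrite /= muln0.
- by rewrite sumn_wheel_sizes wm.
exists (fun mu => (mu == lam)%:R); rewrite (bigD1 lam) //= eqxx scale1r big1 ?addr0.
  by rewrite polywheel_val; apply/esym/wheel_val_perm.
by move=> mu /negbTE ->; rewrite scale0r.
Qed.

Lemma in_polywheel_subspace_sum I (r : seq I) (c : I -> rat) (F : I -> graph_homology k) :
  (forall i, in_polywheel_subspace (F i)) ->
  in_polywheel_subspace (\sum_(i <- r) c i *: F i).
Proof.
move=> HF; elim: r => [|i r [d IH]].
  exists (fun _ => 0); rewrite big_nil big1 // => lam _; exact: scale0r.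
have [d' E] := HF i; exists (fun lam => c i * d' lam + d lam).
rewrite big_cons IH E scaler_sumr -big_split; apply: eq_bigr => lam _ /=.
by rewrite scalerDl scalerA.
Qed.

End ToddClass.

Theorem proposition13 (k : nat) (hk : (1 <= k)%N) :
  in_polywheel_subspace (gclass (theta_graph k)) /\
  (forall a : intpart k.*2 -> rat,
     Td_inv_sqrt k =
       \sum_(lam : intpart k.*2 | is_even lam) a lam *: s_monomial lam ->
     gclass (theta_graph k) =
       (48%:R ^+ k * k`!%:R) *:
         \sum_(lam : intpart k.*2 | is_even lam) a lam *: polywheel lam).
Proof.
(* Both claims read off the same linear functional: monomial by monomial for membership in the span,
   and on the given expansion for the formula. *)
split=> [|a Td]; rewrite Td_inv_sqrt_eval.
  rewrite /mpoly_eval scaler_sumr.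
  under eq_bigr => m _ do rewrite scalerA.
  by apply: in_polywheel_subspace_sum => m; apply: wheel_mon_in_span.
congr (_ *: _); rewrite Td mpoly_eval_sum; apply: eq_bigr => lam elam.
by rewrite mpoly_evalZ s_monomial_eval.
Qed.
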